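(* Let $n\ge 5$ and let $P$ be a polynomial of degree $n$ with real coefficients that satisfies properties A, B, C, D, E, F, G and H listed in the context. Then $P$ is locally extremal.
   Context: For an integer $n\ge 2$, $S(n)$ denotes the set of all complex polynomials of degree $n$ all of whose roots lie in the closed unit disk. For a polynomial $P$ of degree $n$ with roots $z_1,\dots,z_n$ and critical points (roots of $P'$) $\zeta_1,\dots,\zeta_{n-1}$, both listed with multiplicity, define $d(P)=\max_{1\le i\le n}\{\min_{1\le j\le n-1}|z_i-\zeta_j|\}$. For $\epsilon>0$, the $\epsilon$-neighborhood of $P\in S(n)$ is the set of all $Q\in S(n)$ whose roots can be paired (bijectively, with multiplicity) with the roots of $P$ so that in each pair the difference of the roots has modulus less than $\epsilon$. A polynomial $P\in S(n)$ is locally extremal if there is some $\epsilon>0$ such that $d(P)\ge d(Q)$ for all $Q$ in the $\epsilon$-neighborhood of $P$. Properties of a real polynomial $P$ of degree $n\ge5$: A: All roots of $P$ lie in the closed unit disk. B: All roots of $P$ that are on the unit circle are simple. C: $P$ has a root at $\beta$, with $0<\beta<1$. D: All critical points of $P$ lie on a circle of positive radius centered at $\beta$. E: $P$ has a real critical point $a<\beta$ of order $n-3$. Notation: $z_1,\dots,z_n$ are the roots of $P$, numbered so that $z_1,\dots,z_m$ are those on the unit circle; $\zeta_1,\dots,\zeta_{n-1}$ are the critical points of $P$, numbered so that $\zeta_j=a$ for $j\ge3$. F: For each $z_i\ne\beta$, we have $\min_{1\le j\le n-1}|z_i-\zeta_j|<\min_{1\le j\le n-1}|\beta-\zeta_j|<1$.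 Up to a constant multiple, $P(z)=\int_\beta^z\prod_{j=1}^{n-1}(w-\zeta_j)\,dw$, so the roots of $P$ are regarded as functions of $\beta,\zeta_1,\dots,\zeta_{n-1}$ (treated as independent complex variables); each simple root $z_i$ is a differentiable function of these variables near their given values, and $\frac{\partial z_i}{\partial\beta}$, $\frac{\partial z_i}{\partial\zeta_j}$ denote its partial derivatives evaluated at the given values. For real $\Delta\beta$ and complex $\Delta\zeta_1,\dots,\Delta\zeta_{n-1}$ define $$E_k=-\operatorname{Re}\left[\frac{\Delta\zeta_k-\Delta\beta}{\zeta_k-\beta}\right],\quad F_k=0\qquad(k=1,2),$$ $$E_3=\frac{\operatorname{Re}\left[\sum_{j=3}^{n-1}\Delta\zeta_j\right]-(n-3)\Delta\beta}{\beta-a},\qquad F_3=-\frac{\sum_{j=3}^{n-1}(\operatorname{Im}[\Delta\zeta_j])^2}{2(\beta-a)^2},$$ and for $i=1,\dots,m$ $$E_{i+3}=\operatorname{Re}\left[\frac1{z_i}\frac{\partial z_i}{\partial\beta}\right]\Delta\beta+\sum_{j=1}^2\operatorname{Re}\left[\frac1{z_i}\frac{\partial z_i}{\partial\zeta_j}\Delta\zeta_j\right]+\operatorname{Re}\left[\frac1{z_i}\frac{\partial z_i}{\partial\zeta_3}\sum_{j=3}^{n-1}\Delta\zeta_j\right],$$ $$F_{i+3}=-\operatorname{Re}\left[\frac1{2z_iP'(z_i)}\int_\beta^{z_i}\frac{P'(w)\,dw}{(w-a)^2}\right]\sum_{j=3}^{n-1}(\operatorname{Im}[\Delta\zeta_j])^2.$$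 For fixed $P$, the $m+3$ expressions $E_k$ are linear in the 7 real ''variables'' $\Delta\beta$, $\operatorname{Re}[\Delta\zeta_1]$, $\operatorname{Im}[\Delta\zeta_1]$, $\operatorname{Re}[\Delta\zeta_2]$, $\operatorname{Im}[\Delta\zeta_2]$, $\operatorname{Re}[\sum_{j=3}^{n-1}\Delta\zeta_j]$, $\operatorname{Im}[\sum_{j=3}^{n-1}\Delta\zeta_j]$, and the $F_k$ are constant multiples of the eighth real ''variable'' $\sum_{j=3}^{n-1}(\operatorname{Im}[\Delta\zeta_j])^2$. G: There are constants $c_k>0$ (depending on $P$, but independent of the 8 ''variables'') such that, identically in the variables, $\sum_{k=1}^{m+3}c_kE_k=0$ and $\sum_{k=1}^{m+3}c_kF_k=\sum_{j=3}^{n-1}(\operatorname{Im}[\Delta\zeta_j])^2$. H: The coefficient matrix of the linear system $\{E_k=0:k=1,\dots,m+3\}$ in the 7 ''variables'' has rank 7. *)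

(* Defs.v *)
From HB Require Import structures.
From mathcomp Require Import all_boot all_order all_algebra.
From mathcomp Require Import complex.
From mathcomp Require Import all_classical all_reals all_analysis.

Set Implicit Arguments.
Unset Strict Implicit.
Unset Printing Implicit Defensive.

Import Order.TTheory GRing.Theory Num.Theory.
Import numFieldNormedType.Exports.

Local Open Scope classical_set_scope.
Local Open Scope ring_scope.
Local Open Scope complex_scope.

(* The topology and the normed space structure of R[i] over itself, transferred
   in the way numFieldNormedType does it for the abstract numeric fields. *)
HB.instance Definition _ (R : realType) := PseudoPointedMetric.copy R[i] R[i]^o.
HB.instance Definition _ (R : realType) := GRing.ComAlgebra.copy R[i] R[i]^o.
HB.instance Definition _ (R : realType) := Vector.copy R[i] R[i]^o.
HB.instance Definition _ (R : realType) := NormedModule.copy R[i] R[i]^o.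

(* Throughout, R is a model of the real numbers and R[i] of the complex
   numbers.  The norm `|z| of z : R[i] lives in R[i]; ComplexField.Normc.normc
   is the same modulus with values in R. *)

Section Extremality.
Variable R : realType.
Local Notation C := R[i].
Implicit Types (P Q : {poly C}) (s : seq C) (z w : C).

Definition cdist z w : R := ComplexField.Normc.normc (z - w).

(* s lists the roots of P with multiplicity (when P != 0). *)
Definition lists_roots P s : Prop :=
  P = lead_coef P *: \prod_(z <- s) ('X - z%:P).

Definition croots P : seq C := sval (closed_field_poly_normal P).

(* The minimum of cdist z w over w in s; it is folded from the first entry of s,
   so it is the intended minimum as soon as s is nonempty. *)
Definition mindist s z : R :=
  \big[Num.min/cdist z s`_0]_(w <- s) cdist z w.

(* The maximum may start from 0 because all the distances are nonnegative. *)
Definition dmax P : R :=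
  \big[Num.max/0]_(z <- croots P) mindist (croots P^`()) z.

Definition inS (n : nat) P : Prop :=
  size P = n.+1 /\ (forall z, root P z -> `|z| <= 1).

Definition in_nbhd (n : nat) (eps : R) P Q : Prop :=
  inS n Q /\
  exists zs ws : n.-tuple C,
    [/\ lists_roots P zs, lists_roots Q ws &
        forall i : 'I_n, cdist (tnth zs i) (tnth ws i) < eps].

Definition locally_extremal (n : nat) P : Prop :=
  inS n P /\
  exists2 eps : R, 0 < eps & forall Q, in_nbhd n eps P Q -> dmax Q <= dmax P.

End Extremality.

Section RootFunctions.
Variable R : realType.
Local Notation C := R[i].

(* The integral of f from u to v along the segment [u, v].  It is applied
   below to functions which agree with a polynomial off a finite set, for which
   the choice of the path is immaterial. *)
Definition cint (f : C -> C) (u v : C) : C :=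
  let g := fun t : R => f (u + t%:C * (v - u)) * (v - u) in
  (\int[lebesgue_measure]_(t in `[0, 1]) complex.Re (g t))%R +i*
  (\int[lebesgue_measure]_(t in `[0, 1]) complex.Im (g t))%R.

(* For p = (beta, zeta): the value at z of the polynomial which vanishes at
   beta and has the entries of zeta as its critical points, normalized by
   having a monic derivative. *)
Definition primitive (q : nat) (p : C * 'rV[C]_q) (z : C) : C :=
  cint (fun w => \prod_(j < q) (w - p.2 0 j)) p.1 z.

(* Z expresses, near p0, the root z0 of [primitive p0] as a function of the
   parameters.  When z0 is a simple root such a Z exists, and any two of them
   agree in a neighborhood of p0. *)
Definition is_root_function (q : nat) (p0 : C * 'rV[C]_q) (z0 : C)
    (Z : C * 'rV[C]_q -> C) : Prop :=
  [/\ Z p0 = z0,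
      {for p0, continuous Z} &
      \forall p \near p0, primitive p (Z p) = 0].

Definition root_function (q : nat) (p0 : C * 'rV[C]_q) (z0 : C) :
    C * 'rV[C]_q -> C :=
  xget (fun=> 0) [set Z | is_root_function p0 z0 Z].

Variables (beta : C) (zeta : seq C) (z0 : C).

Definition param : C * 'rV[C]_(size zeta) :=
  (beta, \row_(j < size zeta) zeta`_j).

Definition dz_dbeta : C :=
  'D_((1, 0) : C * 'rV[C]_(size zeta)) (root_function param z0) param.

(* The partial derivative in the entry of index j (counted from 0) of zeta. *)
Definition dz_dzeta (j : nat) : C :=
  'D_((0, \row_(l < size zeta) (l == j :> nat)%:R) : C * 'rV[C]_(size zeta))
    (root_function param z0) param.

End RootFunctions.

Section LinearForms.
Variable R : realType.
Local Notation C := R[i].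

(* All indices are shifted to start from 0: z`_0, ..., z`_(n-1) are the roots
   of P, with the m first ones on the unit circle; zeta`_0, ..., zeta`_(n-2)
   are its critical points, with zeta`_j = a for j >= 2; and E k, F k, c k with
   k < m + 3 stand for E_(k+1), F_(k+1), c_(k+1). *)
Variables (n : nat) (P : {poly C}) (beta a : R) (z zeta : seq C).

(* db, d1, d2 and dS are Delta beta, Delta zeta_1, Delta zeta_2 and the sum of
   the Delta zeta_j for 3 <= j <= n - 1. *)
Definition E (db : R) (d1 d2 dS : C) (k : nat) : R :=
  match k with
  | 0 => - complex.Re ((d1 - db%:C) / (zeta`_0 - beta%:C))
  | 1 => - complex.Re ((d2 - db%:C) / (zeta`_1 - beta%:C))
  | 2 => (complex.Re dS - (n - 3)%:R * db) / (beta - a)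
  | i.+3 =>
      complex.Re ((z`_i)^-1 * dz_dbeta beta%:C zeta z`_i) * db
      + (complex.Re ((z`_i)^-1 * dz_dzeta beta%:C zeta z`_i 0 * d1)
         + complex.Re ((z`_i)^-1 * dz_dzeta beta%:C zeta z`_i 1 * d2))
      + complex.Re ((z`_i)^-1 * dz_dzeta beta%:C zeta z`_i 2 * dS)
  end.

(* s2 is the sum of the (Im (Delta zeta_j))^2 for 3 <= j <= n - 1. *)
Definition F (s2 : R) (k : nat) : R :=
  match k with
  | 0 | 1 => 0
  | 2 => - (s2 / (2 * (beta - a) ^+ 2))
  | i.+3 =>
      - complex.Re ((2 * z`_i * P^`().[z`_i])^-1 *
          cint (fun w => P^`().[w] / (w - a%:C) ^+ 2) beta%:C z`_i) * s2
  end.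

(* dzeta j is Delta zeta_(j+1); only its values at j < n - 1 are used. *)
Definition propG (m : nat) : Prop :=
  exists2 c : nat -> R, (forall k, (k < m + 3)%N -> 0 < c k) &
  forall (db : R) (dzeta : nat -> C),
    let dS := \sum_(2 <= j < n.-1) dzeta j in
    let s2 := \sum_(2 <= j < n.-1) complex.Im (dzeta j) ^+ 2 in
    \sum_(k < m + 3) c k * E db (dzeta 0) (dzeta 1) dS k = 0 /\
    \sum_(k < m + 3) c k * F s2 k = s2.

(* E as a function of the row of its 7 real variables. *)
Definition E7 (v : 'rV[R]_7) (k : nat) : R :=
  E (v 0 0) (v 0 1 +i* v 0 2) (v 0 3 +i* v 0 4) (v 0 5 +i* v 0 6) k.

(* E7 being linear, the coefficient of the variable l in the form k is the
   value of the form at the l-th unit vector. *)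
Definition coefE (m : nat) : 'M[R]_(m + 3, 7) :=
  \matrix_(k < m + 3, l < 7) E7 (delta_mx 0 l) k.

Definition propH (m : nat) : Prop := \rank (coefE m) = 7.

End LinearForms.

(* Main.v *)
Require Import Defs.
From mathcomp Require Import all_boot all_order all_algebra.
From mathcomp Require Import complex ring lra.
From mathcomp Require Import all_classical all_reals all_analysis.
From mathcomp Require Import measurable_realfun.

Import Order.TTheory GRing.Theory Num.Theory.
Import numFieldNormedType.Exports.
Local Open Scope classical_set_scope.
Local Open Scope ring_scope.
Local Open Scope complex_scope.

(** Suppose that polynomials Q converge to P with d(Q) > d(P).  By property F
    and continuity, the root of Q realizing d(Q) is the one near beta, and after
    a rotation it is real.  Write D for the sum of the moduli of the seven real
    variables and of s2, the sum of the squares of the Im(Delta zeta_j), j >= 3.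
    That every critical point of Q is farther from this root than |beta - a|,
    and that the roots of Q near the unit circle have modulus at most 1, read
    E_k + F_k <= o(D) for all k, after expanding to second order in the
    Im(Delta zeta_j) and to first order in everything else.  Since
    sum c_k F_k = s2 and sum c_k E_k = 0 with c_k > 0, this gives s2 = o(D),
    then E_k = o(D) for all k, and by the rank hypothesis H all seven variables
    are o(D).  Hence D = o(D), so that D = 0 eventually: Q has the same root
    beta and the same critical points zeta_1, zeta_2 as P, a contradiction. *)

(** The obstacle is that the Delta zeta_j with j >= 3 enter the forms E_k only through their sum, so
    D does not visibly control each of them, and that their imaginary parts are only of order
    sqrt(D). The distance inequalities supply the missing control: they bound every Re(Delta zeta_j)
    - Delta beta from above by a multiple of s2, and since these numbers have a sum that is O(D),
    each of them is O(D). Then products of two increments are O(D), only products of two imaginary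
    parts can fail to be o(D), and products of three are o(D). The square of the sum of the Delta
    zeta_j is o(D) too, so their second elementary symmetric function is s2 / 2 + o(D): this is the
    source of the F_k. Roots are followed without an implicit function theorem. A small value of a
    monic polynomial forces a root nearby, and the first-order variation of that root comes from
    exact polynomial difference quotients. The rotation multiplies by |b| / b, which preserves the
    unit disk and all distances and makes Delta beta real. *)

(** * O and o along a filter *)

Section Landau.
Context {K : numFieldType} {T : Type} {F : set_system T} {FF : Filter F}.
Implicit Types D u v : T -> K.

(** Both functions take values in the same numeric field, [R] or [R[i]]; a real gauge is embedded in
    [R[i]] when it measures a complex quantity. *)
Definition isbigO D u := exists2 M : K, 0 < M &
  \forall t \near F, `|u t| <= M * `|D t|.

Definition islittleo D u := forall e : K, 0 < e ->
  \forall t \near F, `|u t| <= e * `|D t|.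

Lemma isbigO_eq {D u} v : (\forall t \near F, u t = v t) ->
  isbigO D v -> isbigO D u.
Proof.
move=> uv [M M0 vM]; exists M => //.
by apply: filterS2 uv vM => t ->.
Qed.

Lemma islittleo_eq {D u} v : (\forall t \near F, u t = v t) ->
  islittleo D v -> islittleo D u.
Proof. by move=> uv vo e /vo; apply: filterS2 uv => t ->. Qed.

Lemma islittleo_eqfun {D u} v : u =1 v -> islittleo D v -> islittleo D u.
Proof. by move=> uv; apply: islittleo_eq; apply: nearW. Qed.

Lemma isbigO_eqfun {D u} v : u =1 v -> isbigO D v -> isbigO D u.
Proof. by move=> uv; apply: isbigO_eq; apply: nearW. Qed.

Lemma islittleo_bigO D u : islittleo D u -> isbigO D u.
Proof. by move=> /(_ 1 ltr01) uo; exists 1. Qed.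

Lemma isbigO_refl D : isbigO D D.
Proof. by exists 1 => //; apply: nearW => t; rewrite mul1r. Qed.

Lemma isbigO0 D : isbigO D (fun=> 0).
Proof. by exists 1 => //; apply: nearW => t; rewrite normr0 mul1r. Qed.

Lemma islittleo0 D : islittleo D (fun=> 0).
Proof. by move=> e e0; apply: nearW => t; rewrite normr0 mulr_ge0 // ltW. Qed.

Lemma isbigO1_cst (c : K) : isbigO (fun=> 1) (fun=> c).
Proof.
exists (`|c| + 1); first by rewrite ltr_wpDl.
by apply: nearW => t; rewrite normr1 mulr1 lerDl.
Qed.

Lemma isbigO_le {D u} v : (\forall t \near F, `|u t| <= `|v t|) ->
  isbigO D v -> isbigO D u.
Proof.
move=> uv [M M0 vM]; exists M => //.
by apply: filterS2 uv vM => t; apply: le_trans.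
Qed.

Lemma islittleo_le {D u} v : (\forall t \near F, `|u t| <= `|v t|) ->
  islittleo D v -> islittleo D u.
Proof.
by move=> uv vo e /vo; apply: filterS2 uv => t; apply: le_trans.
Qed.

Lemma isbigOD D u v : isbigO D u -> isbigO D v -> isbigO D (fun t => u t + v t).
Proof.
move=> [M M0 uM] [N N0 vN]; exists (M + N); first exact: addr_gt0.
apply: filterS2 uM vN => t ut vt.
by rewrite (le_trans (ler_normD _ _)) // mulrDl lerD.
Qed.

Lemma isbigON D u : isbigO D u -> isbigO D (fun t => - u t).
Proof. by apply: isbigO_le; apply: nearW => t; rewrite normrN. Qed.

Lemma isbigOB D u v : isbigO D u -> isbigO D v -> isbigO D (fun t => u t - v t).
Proof. by move=> uO /isbigON vO; apply: isbigOD. Qed.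

Lemma islittleoD D u v :
  islittleo D u -> islittleo D v -> islittleo D (fun t => u t + v t).
Proof.
move=> uo vo e e0; have e20 : 0 < e / 2 by rewrite divr_gt0.
apply: filterS2 (uo _ e20) (vo _ e20) => t ut vt.
by rewrite (le_trans (ler_normD _ _)) // [e]splitr mulrDl lerD.
Qed.

Lemma islittleoN D u : islittleo D u -> islittleo D (fun t => - u t).
Proof. by apply: islittleo_le; apply: nearW => t; rewrite normrN. Qed.

Lemma islittleoB D u v :
  islittleo D u -> islittleo D v -> islittleo D (fun t => u t - v t).
Proof. by move=> uo /islittleoN vo; apply: islittleoD. Qed.

Lemma isbigO_mul D1 D2 u v : isbigO D1 u -> isbigO D2 v ->
  isbigO (fun t => D1 t * D2 t) (fun t => u t * v t).
Proof.
move=> [M M0 uM] [N N0 vN]; exists (M * N); first exact: mulr_gt0.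
apply: filterS2 uM vN => t ut vt.
by rewrite !normrM mulrACA ler_pM.
Qed.

Lemma islittleo_mul D1 D2 u v : islittleo D1 u -> isbigO D2 v ->
  islittleo (fun t => D1 t * D2 t) (fun t => u t * v t).
Proof.
move=> uo [N N0 vN] e e0; have eN0 : 0 < e / N by rewrite divr_gt0.
apply: filterS2 (uo _ eN0) vN => t ut vt.
rewrite !normrM (le_trans (ler_pM _ _ ut vt)) // mulrACA.
by rewrite divfK // gt_eqF.
Qed.

Lemma isbigO_trans D1 D2 u : isbigO D2 D1 -> isbigO D1 u -> isbigO D2 u.
Proof.
move=> [M M0 uM] [N N0 vN]; exists (N * M); first exact: mulr_gt0.
apply: filterS2 uM vN => t ut vt.
by rewrite (le_trans vt) // -mulrA ler_pM2l.
Qed.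

Lemma islittleo_trans D1 D2 u : isbigO D2 D1 -> islittleo D1 u -> islittleo D2 u.
Proof.
move=> [M M0 uM] uo e e0; have eM0 : 0 < e / M by rewrite divr_gt0.
apply: filterS2 uM (uo _ eM0) => t ut vt.
rewrite (le_trans vt) // (le_trans (ler_wpM2l (ltW eM0) ut)) // mulrA.
by rewrite divfK // gt_eqF.
Qed.

Lemma isbigO_Mbdr D u v : isbigO D u -> isbigO (fun=> 1) v ->
  isbigO D (fun t => u t * v t).
Proof.
move=> uO vO; have := isbigO_mul _ _ _ _ uO vO.
by apply: isbigO_trans; under eq_fun do rewrite mulr1; apply: isbigO_refl.
Qed.

Lemma isbigO_Mbdl D u v : isbigO (fun=> 1) u -> isbigO D v ->
  isbigO D (fun t => u t * v t).
Proof.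
move=> uO vO; apply: isbigO_eqfun (isbigO_Mbdr _ _ _ vO uO) => t.
by rewrite mulrC.
Qed.

Lemma islittleo_Mbdr D u v : islittleo D u -> isbigO (fun=> 1) v ->
  islittleo D (fun t => u t * v t).
Proof.
move=> uO vO; have := islittleo_mul _ _ _ _ uO vO.
by apply: islittleo_trans; under eq_fun do rewrite mulr1; apply: isbigO_refl.
Qed.

Lemma islittleo_Mbdl D u v : isbigO (fun=> 1) u -> islittleo D v ->
  islittleo D (fun t => u t * v t).
Proof.
move=> uO vO; apply: islittleo_eqfun (islittleo_Mbdr _ _ _ vO uO) => t.
by rewrite mulrC.
Qed.

Lemma islittleo_Mol D u v : islittleo (fun=> 1) u -> isbigO D v ->
  islittleo D (fun t => u t * v t).
Proof.
move=> uO vO; have := islittleo_mul _ _ _ _ uO vO.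
by apply: islittleo_trans; under eq_fun do rewrite mul1r; apply: isbigO_refl.
Qed.

Lemma islittleo_Mor D u v : isbigO D u -> islittleo (fun=> 1) v ->
  islittleo D (fun t => u t * v t).
Proof.
move=> uO vO; apply: islittleo_eqfun (islittleo_Mol _ _ _ vO uO) => t.
by rewrite mulrC.
Qed.

Lemma isbigO_Zl D c u : isbigO D u -> isbigO D (fun t => c * u t).
Proof. by apply: isbigO_Mbdl; apply: isbigO1_cst. Qed.

Lemma islittleo_Zl D c u : islittleo D u -> islittleo D (fun t => c * u t).
Proof. by apply: islittleo_Mbdl; apply: isbigO1_cst. Qed.

Lemma isbigO_sum (I : eqType) (r : seq I) D (u : I -> T -> K) :
  (forall i, i \in r -> isbigO D (u i)) ->
  isbigO D (fun t => \sum_(i <- r) u i t).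
Proof.
elim: r => [_|i r IH uO].
  by under eq_fun do rewrite big_nil; apply: isbigO0.
under eq_fun do rewrite big_cons; apply: isbigOD.
  by apply: uO; rewrite mem_head.
by apply: IH => j jr; apply: uO; rewrite inE jr orbT.
Qed.

Lemma islittleo_sum (I : eqType) (r : seq I) D (u : I -> T -> K) :
  (forall i, i \in r -> islittleo D (u i)) ->
  islittleo D (fun t => \sum_(i <- r) u i t).
Proof.
elim: r => [_|i r IH uO].
  by under eq_fun do rewrite big_nil; apply: islittleo0.
under eq_fun do rewrite big_cons; apply: islittleoD.
  by apply: uO; rewrite mem_head.
by apply: IH => j jr; apply: uO; rewrite inE jr orbT.
Qed.

(** Convergence is stated without a topology on [K], so that the o calculus applies to it directly;
    [tendsto_cvg] makes the link with filter convergence in [R[i]]. *)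
Definition tendsto u (l : K) := islittleo (fun=> 1) (fun t => u t - l).

Lemma tendstoP u l :
  tendsto u l <-> forall e : K, 0 < e -> \forall t \near F, `|u t - l| <= e.
Proof.
split=> ul e /ul; apply: filterS => t.
  by rewrite normr1 mulr1.
by rewrite normr1 mulr1.
Qed.

Lemma tendsto_bigO u l : tendsto u l -> isbigO (fun=> 1) u.
Proof.
move=> /islittleo_bigO ul; apply: isbigO_eqfun (isbigOD _ _ _ ul (isbigO1_cst l)).
by move=> t /=; rewrite subrK.
Qed.

Lemma tendsto_cst c : tendsto (fun=> c) c.
Proof.
by apply: islittleo_eqfun (islittleo0 _) => t /=; rewrite subrr.
Qed.

Lemma tendsto_eq {u} v l : (\forall t \near F, u t = v t) ->
  tendsto v l -> tendsto u l.
Proof. by move=> uv; apply: islittleo_eq; apply: filterS uv => t ->. Qed.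

Lemma tendsto0 u : tendsto u 0 <-> islittleo (fun=> 1) u.
Proof. by split; apply: islittleo_eqfun => t; rewrite subr0. Qed.

Lemma tendstoD u v a b : tendsto u a -> tendsto v b ->
  tendsto (fun t => u t + v t) (a + b).
Proof.
move=> ua vb; apply: islittleo_eqfun (islittleoD _ _ _ ua vb) => t /=.
by rewrite opprD addrACA.
Qed.

Lemma tendstoM u v a b : tendsto u a -> tendsto v b ->
  tendsto (fun t => u t * v t) (a * b).
Proof.
move=> ua vb.
apply: (@islittleo_eqfun _ _ (fun t => (u t - a) * v t + a * (v t - b))).
  by move=> t; ring.
apply: islittleoD; last exact: islittleo_Zl.
exact: islittleo_Mbdr (tendsto_bigO _ _ vb).
Qed.

Lemma tendstoN u a : tendsto u a -> tendsto (fun t => - u t) (- a).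
Proof.
move=> /islittleoN; apply: islittleo_eqfun => t /=; ring.
Qed.

Lemma tendstoB u v a b : tendsto u a -> tendsto v b ->
  tendsto (fun t => u t - v t) (a - b).
Proof. by move=> ua /tendstoN vb; apply: tendstoD. Qed.

Lemma tendstoX u a n : tendsto u a -> tendsto (fun t => u t ^+ n) (a ^+ n).
Proof.
move=> ua; elim: n => [|n IH]; first exact: tendsto_cst.
rewrite exprS; have := tendstoM _ _ _ _ ua IH.
by apply: islittleo_eqfun => t; rewrite exprS.
Qed.

Lemma tendsto_sum (I : eqType) (r : seq I) (u : I -> T -> K) (l : I -> K) :
  (forall i, i \in r -> tendsto (u i) (l i)) ->
  tendsto (fun t => \sum_(i <- r) u i t) (\sum_(i <- r) l i).
Proof.
move=> ul; apply: (@islittleo_eqfun _ _ (fun t => \sum_(i <- r) (u i t - l i))).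
  by move=> t; rewrite sumrB.
exact: islittleo_sum.
Qed.

Lemma tendsto_neq u a b : tendsto u a -> a != b -> \forall t \near F, u t != b.
Proof.
move=> ua ab; have ab0 : 0 < `|a - b| by rewrite normr_gt0 subr_eq0.
have /ua : 0 < `|a - b| / 2 by rewrite divr_gt0.
apply: filterS => t; apply: contraTneq => ->.
rewrite normr1 mulr1 distrC lt_geF // ltr_pdivrMr // ltr_pMr // ltr1n //.
Qed.

Lemma tendstoV u a : tendsto u a -> a != 0 ->
  tendsto (fun t => (u t)^-1) a^-1.
Proof.
move=> ua a0; apply/tendstoP => e e0.
have na0 : 0 < `|a| by rewrite normr_gt0.
have h0 : 0 < `|a| / 2 by rewrite divr_gt0.
(* As |u| >= |a| / 2 eventually, this bound on |u - a| gives |u - a| / (|u| |a|) <= e. *)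
have h1 : 0 < e * (`|a| / 2 * `|a|) by rewrite !mulr_gt0.
have := ua; move=> /tendstoP /(_ _ h0) ua1; move: ua => /tendstoP /(_ _ h1) ua2.
apply: filterS2 ua1 ua2 => t ut1 ut2.
have uh : `|a| / 2 <= `|u t|.
  rewrite -(lerD2r (`|a| / 2)) -splitr.
  rewrite (le_trans _ (lerD (lexx _) ut1)) //.
  by rewrite distrC (le_trans _ (ler_normD _ _)) // addrC subrK.
have u0 : u t != 0 by rewrite -normr_gt0 (lt_le_trans h0).
have -> : (u t)^-1 - a^-1 = (u t - a) * - (u t * a)^-1.
  by field; apply/andP.
rewrite normrM normrN normfV normrM ler_pdivrMr; last first.
  by rewrite mulr_gt0 // normr_gt0.
by rewrite (le_trans ut2) // ler_pM2l // ler_pM2r.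
Qed.

End Landau.

(** * Polynomials depending on a parameter *)

Section Primitive.
Context {K : numFieldType}.
Implicit Types p q : {poly K}.

(** The coefficient of index 0 is a division by 0, hence 0: this is the antiderivative that vanishes
    at 0. *)
Definition antideriv p : {poly K} :=
  \poly_(i < (size p).+1) (p`_i.-1 / i%:R).

Lemma coef_antideriv p i : (antideriv p)`_i = p`_i.-1 / i%:R.
Proof.
rewrite coef_poly; case: ltnP => // pi; rewrite nth_default ?mul0r //.
by case: i pi.
Qed.

Lemma size_antideriv p : (size (antideriv p) <= (size p).+1)%N.
Proof. exact: size_poly. Qed.

Lemma deriv_antideriv p : (antideriv p)^`() = p.
Proof.
apply/polyP => i.
by rewrite coef_deriv coef_antideriv -[LHS]mulr_natr divfK ?pnatr_eq0.
Qed.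

Lemma antideriv_deriv p : antideriv p^`() = p - (p`_0)%:P.
Proof.
apply/polyP => -[|i]; rewrite coef_antideriv coefB coefC /=.
  by rewrite invr0 mulr0 subrr.
by rewrite coef_deriv -[X in X / _]mulr_natr mulfK ?subr0 // pnatr_eq0.
Qed.

Lemma antiderivD p q : antideriv (p + q) = antideriv p + antideriv q.
Proof. by apply/polyP => i; rewrite coefD !coef_antideriv coefD mulrDl. Qed.

Lemma antiderivZ c p : antideriv (c *: p) = c *: antideriv p.
Proof. by apply/polyP => i; rewrite coefZ !coef_antideriv coefZ mulrA. Qed.

Lemma size_polyB_leq p q N : (size p <= N)%N -> (size q <= N)%N ->
  (size (p - q)%R <= N)%N.
Proof.
by move=> sp sq; rewrite (leq_trans (size_polyD _ _)) // size_polyN geq_max sp.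
Qed.

(** The path-free form of the integral from [u] to [v]; [cint_horner] identifies it with [cint]. *)
Definition pint p (u v : K) := (antideriv p).[v] - (antideriv p).[u].

Lemma pintD p q u v : pint (p + q) u v = pint p u v + pint q u v.
Proof. by rewrite /pint antiderivD !hornerD; ring. Qed.

Lemma pintZ c p u v : pint (c *: p) u v = c * pint p u v.
Proof. by rewrite /pint antiderivZ !hornerZ mulrBr. Qed.

Lemma pintN p u v : pint (- p) u v = - pint p u v.
Proof. by rewrite -scaleN1r pintZ mulN1r. Qed.

Lemma pint0 u v : pint 0 u v = 0.
Proof. by rewrite -(scale0r 0) pintZ mul0r. Qed.

Lemma pint_deriv p u v : pint p^`() u v = p.[v] - p.[u].
Proof. by rewrite /pint antideriv_deriv !hornerD !hornerN !hornerC; ring. Qed.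

(** The difference quotient at [z] is itself a polynomial, so its limit follows from the continuity
    of evaluation, with no remainder to estimate. *)
Lemma horner_sub_factor p z : exists2 g : {poly K},
  forall w, p.[w] - p.[z] = (w - z) * g.[w] & g.[z] = p^`().[z].
Proof.
have : root (p - p.[z]%:P) z by rewrite rootE !hornerE subrr.
case/factor_theorem => g pg; exists g.
  by move=> w; have := congr1 (horner^~ w) pg; rewrite !hornerE mulrC.
have /(congr1 (horner^~ z)) := congr1 deriv pg.
by rewrite derivM derivXsubC derivB derivC subr0 !hornerE subrr mulr0 add0r => ->.
Qed.

End Primitive.

Section PolyLandau.
Context {K : numFieldType} {T : Type} {F : set_system T} {FF : Filter F}.
Implicit Types (D : T -> K) (u v : T -> {poly K}) (p q : {poly K}).

(** These notions are coefficientwise; the lemmas on evaluation add a bound [N] on the sizes,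
    uniform in the parameter. *)
Definition pbigO D u := forall i, isbigO (F := F) D (fun t => (u t)`_i).
Definition plittleo D u := forall i, islittleo (F := F) D (fun t => (u t)`_i).
Definition ptendsto u p := forall i, tendsto (F := F) (fun t => (u t)`_i) p`_i.

Lemma plittleo_eqfun {D u} v : u =1 v -> plittleo D v -> plittleo D u.
Proof. by move=> uv vo i; apply: islittleo_eqfun (vo i) => t; rewrite uv. Qed.

Lemma pbigO_eqfun {D u} v : u =1 v -> pbigO D v -> pbigO D u.
Proof. by move=> uv vo i; apply: isbigO_eqfun (vo i) => t; rewrite uv. Qed.

Lemma pbigO1_cst (p : {poly K}) : pbigO (fun=> 1) (fun=> p).
Proof. by move=> i; apply: isbigO1_cst. Qed.

Lemma ptendsto_bigO u p : ptendsto u p -> pbigO (fun=> 1) u.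
Proof. by move=> up i; apply: tendsto_bigO (up i). Qed.

Lemma plittleo0 D : plittleo D (fun=> 0).
Proof.
by move=> i; apply: islittleo_eqfun (islittleo0 D) => t; rewrite coef0.
Qed.

Lemma plittleoD D u v :
  plittleo D u -> plittleo D v -> plittleo D (fun t => u t + v t).
Proof.
move=> uo vo i; apply: islittleo_eqfun (islittleoD _ _ _ (uo i) (vo i)) => t.
by rewrite coefD.
Qed.

Lemma plittleoN D u : plittleo D u -> plittleo D (fun t => - u t).
Proof.
by move=> uo i; apply: islittleo_eqfun (islittleoN _ _ (uo i)) => t; rewrite coefN.
Qed.

Lemma plittleoB D u v :
  plittleo D u -> plittleo D v -> plittleo D (fun t => u t - v t).
Proof. by move=> uo /plittleoN; apply: plittleoD. Qed.

Lemma pbigOD D u v : pbigO D u -> pbigO D v -> pbigO D (fun t => u t + v t).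
Proof.
move=> uo vo i; apply: isbigO_eqfun (isbigOD _ _ _ (uo i) (vo i)) => t.
by rewrite coefD.
Qed.

Lemma pbigON D u : pbigO D u -> pbigO D (fun t => - u t).
Proof.
by move=> uo i; apply: isbigO_eqfun (isbigON _ _ (uo i)) => t; rewrite coefN.
Qed.

Lemma pbigOB D u v : pbigO D u -> pbigO D v -> pbigO D (fun t => u t - v t).
Proof. by move=> uo /pbigON; apply: pbigOD. Qed.

Lemma pbigOZ D (c : T -> K) (p : {poly K}) : isbigO (F := F) D c ->
  pbigO D (fun t => c t *: p).
Proof.
move=> cD i; apply: isbigO_eqfun (isbigO_Mbdr _ _ _ cD (isbigO1_cst p`_i)) => t.
by rewrite coefZ.
Qed.

Lemma plittleoZ D (c : T -> K) (p : {poly K}) : islittleo (F := F) D c ->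
  plittleo D (fun t => c t *: p).
Proof.
move=> cD i; apply: islittleo_eqfun (islittleo_Mbdr _ _ _ cD (isbigO1_cst p`_i)) => t.
by rewrite coefZ.
Qed.

Lemma plittleo_Mbdl D u v :
  pbigO (fun=> 1) u -> plittleo D v -> plittleo D (fun t => u t * v t).
Proof.
move=> uO vo i; apply: (@islittleo_eqfun _ _ _ _ _ _
  (fun t => \sum_(j < i.+1) (u t)`_j * (v t)`_(i - j))).
  by move=> t; rewrite coefM.
by apply: islittleo_sum => j _; apply: islittleo_Mbdl.
Qed.

Lemma ptendsto_XsubC (c : T -> K) (l : K) : tendsto (F := F) c l ->
  ptendsto (fun t => 'X - (c t)%:P) ('X - l%:P).
Proof.
move=> cl i; apply: (@islittleo_eqfun _ _ _ _ _ _
  (fun t => - ((c t - l) * (i == 0%N)%:R))).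
  move=> t; rewrite !coefB coefX !coefC; case: (i == 0%N) => /=; ring.
by apply: islittleoN; apply: islittleo_Mbdr => //; apply: isbigO1_cst.
Qed.

Lemma ptendstoM u v p q : ptendsto u p -> ptendsto v q ->
  ptendsto (fun t => u t * v t) (p * q).
Proof.
move=> up vq i; apply: (@tendsto_eq _ _ _ _ _
  (fun t => \sum_(j < i.+1) (u t)`_j * (v t)`_(i - j))).
  by apply: nearW => t; rewrite coefM.
by rewrite coefM; apply: tendsto_sum => j _; apply: tendstoM.
Qed.

Lemma ptendsto_prod (I : eqType) (r : seq I) (u : I -> T -> {poly K})
    (p : I -> {poly K}) :
  (forall i, i \in r -> ptendsto (u i) (p i)) ->
  ptendsto (fun t => \prod_(i <- r) u i t) (\prod_(i <- r) p i).
Proof.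
elim: r => [_ j|i r IH up].
  apply: (@tendsto_eq _ _ _ _ _ (fun=> (1 : {poly K})`_j)).
    by apply: nearW => t; rewrite big_nil.
  by rewrite big_nil; apply: tendsto_cst.
have /(ptendstoM _ _ _ _ (up i (mem_head _ _))) H :
    ptendsto (fun t => \prod_(i <- r) u i t) (\prod_(i <- r) p i).
  by apply: IH => j jr; apply: up; rewrite inE jr orbT.
move=> j; rewrite big_cons; apply: tendsto_eq (H j).
by apply: nearW => t; rewrite big_cons.
Qed.

Lemma pbigO_antideriv D u : pbigO D u -> pbigO D (fun t => antideriv (u t)).
Proof.
move=> uO i; apply: isbigO_eqfun (isbigO_Zl _ i%:R^-1 _ (uO i.-1)) => t.
by rewrite coef_antideriv mulrC.
Qed.

Lemma plittleo_antideriv D u :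
  plittleo D u -> plittleo D (fun t => antideriv (u t)).
Proof.
move=> uO i; apply: islittleo_eqfun (islittleo_Zl _ i%:R^-1 _ (uO i.-1)) => t.
by rewrite coef_antideriv mulrC.
Qed.

Lemma ptendsto_antideriv u p : ptendsto u p ->
  ptendsto (fun t => antideriv (u t)) (antideriv p).
Proof.
move=> up i; rewrite coef_antideriv.
apply: (@tendsto_eq _ _ _ _ _ (fun t => (u t)`_i.-1 * i%:R^-1)).
  by apply: nearW => t; rewrite coef_antideriv.
by apply: tendstoM; [exact: up | exact: tendsto_cst].
Qed.

Lemma horner_plittleo N D u (w : T -> K) : (forall t, (size (u t) <= N)%N) ->
  plittleo D u -> isbigO (F := F) (fun=> 1) w ->
  islittleo (F := F) D (fun t => (u t).[w t]).
Proof.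
move=> su uo wO; apply: (@islittleo_eqfun _ _ _ _ _ _
  (fun t => \sum_(i < N) (u t)`_i * w t ^+ i)).
  by move=> t; rewrite (horner_coef_wide _ (su t)).
apply: islittleo_sum => i _; apply: islittleo_Mbdr => //.
elim: (i : nat) => [|k IH]; first exact: isbigO1_cst.
by apply: isbigO_eqfun (isbigO_Mbdr _ _ _ wO IH) => t; rewrite exprS.
Qed.

Lemma horner_pbigO_sub N D u (w : T -> K) z : (forall t, (size (u t) <= N)%N) ->
  pbigO D u -> tendsto (F := F) w z ->
  islittleo (F := F) D (fun t => (u t).[w t] - (u t).[z]).
Proof.
move=> su uo wz; apply: (@islittleo_eqfun _ _ _ _ _ _
  (fun t => \sum_(i < N) (u t)`_i * (w t ^+ i - z ^+ i))).
  move=> t; rewrite !(horner_coef_wide _ (su t)) -sumrB.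
  by apply: eq_bigr => i _; rewrite mulrBr.
by apply: islittleo_sum => i _; apply: islittleo_Mor => //; apply: tendstoX.
Qed.

Lemma tendsto_horner p (w : T -> K) z : tendsto (F := F) w z ->
  tendsto (F := F) (fun t => p.[w t]) p.[z].
Proof.
exact: (@horner_pbigO_sub (size p) (fun=> 1) (fun=> p) w z _ (pbigO1_cst p)).
Qed.

Lemma ptendsto_horner N u p z : (forall t, (size (u t) <= N)%N) ->
  (size p <= N)%N ->
  ptendsto u p -> tendsto (F := F) (fun t => (u t).[z]) p.[z].
Proof.
move=> su sp up.
apply: (@islittleo_eqfun _ _ _ _ _ _ (fun t => (u t - p).[z])).
  by move=> t; rewrite !hornerE.
apply: (@horner_plittleo N _ _ (fun=> z)); last exact: isbigO1_cst.
  by move=> t; rewrite size_polyB_leq.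
by move=> i; apply: islittleo_eqfun (up i) => t; rewrite coefB.
Qed.

(* First-order variation of the root w near z0 of the primitive of q that
   vanishes at b, when q = p + L + o(D) and b = b0 + O(D). *)
Lemma root_expansion N D (p : {poly K}) (q L : T -> {poly K}) (b w : T -> K)
    (b0 z0 : K) :
  (size p <= N)%N -> (forall t, (size (q t) <= N)%N) ->
  (forall t, (size (L t) <= N)%N) ->
  tendsto (F := F) b b0 -> tendsto (F := F) w z0 ->
  isbigO (F := F) D (fun t => b t - b0) ->
  plittleo D (fun t => q t - p - L t) -> pbigO D L -> p.[z0] != 0 ->
  pint p b0 z0 = 0 -> (\forall t \near F, pint (q t) (b t) (w t) = 0) ->
  islittleo (F := F) D (fun t =>
    w t - z0 - (p.[b0] * (b t - b0) - pint (L t) b0 z0) / p.[z0]).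
Proof.
move=> sp sq sL bb0 wz0 bO qo LO pz0 p0 q0.
have [g gE gz] := horner_sub_factor (antideriv p) z0.
have [h hE hb] := horner_sub_factor (antideriv p) b0.
rewrite deriv_antideriv in gz; rewrite deriv_antideriv in hb.
have gw : tendsto (F := F) (fun t => g.[w t]) p.[z0].
  by rewrite -gz; apply: tendsto_horner.
have hw : tendsto (F := F) (fun t => h.[b t]) p.[b0].
  by rewrite -hb; apply: tendsto_horner.
have gV : tendsto (F := F) (fun t => (g.[w t])^-1) (p.[z0])^-1 by apply: tendstoV.
have gn0 : \forall t \near F, g.[w t] != 0 by apply: tendsto_neq pz0.
pose R t := q t - p - L t.
have sR t : (size (R t) <= N)%N.
  by rewrite !size_polyB_leq.
have sA (u : T -> {poly K}) : (forall t, (size (u t) <= N)%N) ->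
    forall t, (size (antideriv (u t)) <= N.+1)%N.
  by move=> su t; rewrite (leq_trans (size_antideriv _)) ?ltnS ?su.
have evR c l : tendsto (F := F) c l ->
    islittleo (F := F) D (fun t => (antideriv (R t)).[c t]).
  move=> /tendsto_bigO; apply: (@horner_plittleo N.+1); first exact: sA.
  exact: plittleo_antideriv.
have evL c l : tendsto (F := F) c l ->
    islittleo (F := F) D (fun t => (antideriv (L t)).[c t] - (antideriv (L t)).[l]).
  apply: (@horner_pbigO_sub N.+1); first exact: sA.
  exact: pbigO_antideriv.
have ALO c : isbigO (F := F) D (fun t => (antideriv (L t)).[c]).
  apply: (@isbigO_eqfun _ _ _ _ _ _
    (fun t => \sum_(i < N.+1) (antideriv (L t))`_i * c ^+ i)).
    by move=> t; rewrite (horner_coef_wide _ (sA _ sL t)).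
  apply: isbigO_sum => i _; apply: isbigO_Mbdr; last exact: isbigO1_cst.
  exact: pbigO_antideriv.
pose RHS t := p.[b0] * (b t - b0) - pint (L t) b0 z0.
have RHSO : isbigO (F := F) D RHS.
  by apply: isbigOB; [exact: isbigO_Zl | apply: isbigOB].
(* Substituting q = p + L + R in the equation of the root, the part from p is exactly (w - z0) g(w)
   - (b - b0) h(b), because [pint p b0 z0 = 0]. Moving the endpoints of the integral of L to b0 and
   z0 costs o(D), and so does R. *)
have key : islittleo (F := F) D (fun t => (w t - z0) * g.[w t] - RHS t).
  apply: (@islittleo_eq _ _ _ _ _ _ (fun t =>
    (b t - b0) * (h.[b t] - p.[b0])
    - ((antideriv (L t)).[w t] - (antideriv (L t)).[z0])
    + ((antideriv (L t)).[b t] - (antideriv (L t)).[b0])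
    - (antideriv (R t)).[w t] + (antideriv (R t)).[b t])).
    apply: filterS q0 => t q0t.
    rewrite -gE mulrBr -hE /RHS.
    have := q0t; have -> : q t = p + (L t + R t) by rewrite /R; ring.
    rewrite /pint !antiderivD !hornerD => qt0.
    have p0' := p0; rewrite /pint in p0'.
    apply/eqP; rewrite -subr_eq0; apply/eqP.
    (* The goal is the difference of the equations [qt0] and [p0'], so its right-hand side is
       rewritten as 0 - 0 and each 0 is expanded. *)
    rewrite -[RHS in _ = RHS](subrr 0) -{1}qt0 -p0'; ring.
  apply: islittleoD; last exact: evR bb0.
  apply: islittleoB; last exact: evR wz0.
  apply: islittleoD; last exact: evL.
  apply: islittleoB; last exact: evL.
  exact: islittleo_Mor.
(* Division by g(w), which tends to the nonzero value of p at z0; replacing it by this limit costs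
   O(D) o(1). *)
apply: (@islittleo_eq _ _ _ _ _ _ (fun t =>
  ((w t - z0) * g.[w t] - RHS t) * (g.[w t])^-1
   + RHS t * ((g.[w t])^-1 - p.[z0]^-1))).
  apply: filterS gn0 => t gt0; rewrite -/(RHS t).
  by field; apply/andP.
apply: islittleoD; last exact: islittleo_Mor.
by apply: islittleo_Mbdr => //; apply: tendsto_bigO gV.
Qed.

(** Expansion in elementary symmetric functions, the second one given by Newton's identity. Terms of
    degree at least 3 are o(D), since two increments multiply to O(D) and a further one tends to 0.
    The induction starts at two factors, where the expansion is exact. *)
Lemma prod_second_order (Y : {poly K}) D (d : nat -> T -> K) (m N : nat) :
  (forall j, islittleo (F := F) (fun=> 1) (d j)) ->
  (forall j l, isbigO (F := F) D (fun t => d j t * d l t)) ->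
  let r := index_iota m (m + N.+2) in
  plittleo D (fun t => \prod_(j <- r) (Y - (d j t)%:P)
    - (Y ^+ N.+2 - (\sum_(j <- r) d j t) *: Y ^+ N.+1
       + (((\sum_(j <- r) d j t) ^+ 2 - \sum_(j <- r) d j t ^+ 2) / 2) *: Y ^+ N)).
Proof.
move=> do1 ddO /=; elim: N => [|N IH].
  apply: plittleo_eqfun (plittleo0 _) => t.
  rewrite !addnS addn0 !big_nat_recr ?leqW //= !big_geq //.
  have -> : ((0 + d m t + d m.+1 t) ^+ 2 - (0 + d m t ^+ 2 + d m.+1 t ^+ 2)) / 2
     = d m t * d m.+1 t by field.
  rewrite -!mul_polyC !rmorphD !rmorphM /=; ring.
pose S t := \sum_(m <= j < m + N.+2) d j t.
pose e2 t := (S t ^+ 2 - \sum_(m <= j < m + N.+2) d j t ^+ 2) / 2.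
pose R t := \prod_(m <= j < m + N.+2) (Y - (d j t)%:P) -
  (Y ^+ N.+2 - S t *: Y ^+ N.+1 + e2 t *: Y ^+ N).
pose k := (m + N.+2)%N.
(* Besides the old remainder times the new factor, the only error is the third-order term
   [d k t * e2 t]. *)
apply: (@plittleo_eqfun _ _ (fun t =>
  (Y - (d k t)%:P) * R t - (d k t * e2 t) *: Y ^+ N)).
  move=> t; rewrite [in LHS]addnS !big_nat_recr ?leq_addr //= -/k -/(S t).
  have -> : ((S t + d k t) ^+ 2 - (\sum_(m <= i < k) d i t ^+ 2 + d k t ^+ 2)) / 2
     = e2 t + d k t * S t.
    by rewrite /e2 -/k; set s := \sum_(_ <= _ < _) _; field.
  rewrite /R -/k; set P := \prod_(_ <= _ < _) _.
  rewrite -!mul_polyC !rmorphD !rmorphM /=.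
  rewrite !exprS; ring.
apply: plittleoB; last first.
  apply: plittleoZ; apply: islittleo_Mol; first exact: do1.
  apply: (@isbigO_eqfun _ _ _ _ _ _
    (fun t => 2^-1 * (S t * S t - \sum_(m <= j < k) d j t ^+ 2))).
    by move=> t; rewrite /e2 mulrC expr2.
  apply: isbigO_Zl; apply: isbigOB.
    apply: (@isbigO_eqfun _ _ _ _ _ _
      (fun t => \sum_(m <= i < k) \sum_(m <= j < k) d i t * d j t)).
      by move=> t; rewrite /S big_distrl /=; apply: eq_bigr => i _; rewrite big_distrr.
    by apply: isbigO_sum => i _; apply: isbigO_sum => j _.
  by apply: isbigO_sum => i _; under eq_fun do rewrite expr2.
apply: plittleo_Mbdl; last exact: IH.
have : ptendsto (fun t => Y - (d k t)%:P) Y.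
  move=> i; apply: (@islittleo_eqfun _ _ _ _ _ _ (fun t => - (d k t * (i == 0%N)%:R))).
    by move=> t; rewrite coefB coefC; case: (i == 0%N) => /=; ring.
  by apply: islittleoN; apply: islittleo_Mbdr; [exact: do1 | exact: isbigO1_cst].
exact: ptendsto_bigO.
Qed.

End PolyLandau.

(** * Integrals along segments *)

Section SegmentIntegral.
Variable R : realType.
Local Notation C := R[i].

Lemma cReD (x y : C) : complex.Re (x + y) = complex.Re x + complex.Re y.
Proof. by case: x y => [? ?] [? ?]. Qed.

Lemma cImD (x y : C) : complex.Im (x + y) = complex.Im x + complex.Im y.
Proof. by case: x y => [? ?] [? ?]. Qed.

Lemma cReN (x : C) : complex.Re (- x) = - complex.Re x.
Proof. by case: x. Qed.

Lemma cReB (x y : C) : complex.Re (x - y) = complex.Re x - complex.Re y.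
Proof. by case: x y => [? ?] [? ?]. Qed.

Lemma cReM (x y : C) : complex.Re (x * y) =
  complex.Re x * complex.Re y - complex.Im x * complex.Im y.
Proof. by case: x y => [? ?] [? ?]. Qed.

Lemma cImM (x y : C) : complex.Im (x * y) =
  complex.Re x * complex.Im y + complex.Im x * complex.Re y.
Proof. by case: x y => [? ?] [? ?]. Qed.

Lemma cReMr (x : C) (t : R) : complex.Re (x * t%:C) = complex.Re x * t.
Proof. by rewrite cReM /= mulr0 subr0. Qed.

Lemma cImMr (x : C) (t : R) : complex.Im (x * t%:C) = complex.Im x * t.
Proof. by rewrite cImM /= mulr0 add0r. Qed.

Lemma Re_sum (I : Type) (r : seq I) (f : I -> C) :
  complex.Re (\sum_(i <- r) f i) = \sum_(i <- r) complex.Re (f i).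
Proof. by apply: big_morph => //; exact: cReD. Qed.

Lemma Rintegral_horner (p : {poly R}) :
  (\int[lebesgue_measure]_(t in `[0, 1]) p.[t])%R = pint p 0 1.
Proof.
rewrite /Rintegral (@continuous_FTC2 _ _ (horner (antideriv p)) 0 1) //.
- by apply: continuous_subspaceT => x; apply: continuous_horner.
- split.
  + by move=> x _; apply: derivable_horner.
  + by apply: cvg_at_right_filter; apply: continuous_horner.
  + by apply: cvg_at_left_filter; apply: continuous_horner.
- by move=> x _; rewrite -derivE deriv_antideriv.
Qed.

(** Serves for the integrand P'(w) / (w - a)^2, which agrees with a polynomial only off [a], while
    the segment may pass through [a]. Measurability of [f] is inherited from [g] on the complement
    of the point. *)
Lemma Rintegral_eq_off_point (f g : R -> R) (t0 : R) :
  measurable_fun setT g -> (forall t, t != t0 -> f t = g t) ->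
  (\int[lebesgue_measure]_(t in `[0, 1]) f t =
   \int[lebesgue_measure]_(t in `[0, 1]) g t)%R.
Proof.
move=> mg fg; congr fine.
have mf : measurable_fun setT f.
  rewrite -(setUv [set t0]); apply/measurable_funU => //.
    exact: measurableC.
  split; first exact: measurable_fun_set1.
  apply: (eq_measurable_fun g); last exact: measurable_funTS.
  by move=> t; rewrite inE /= => /eqP tt0; rewrite fg.
apply: ae_eq_integral => //.
- by apply/measurable_EFinP; apply: measurable_funTS.
- by apply/measurable_EFinP; apply: measurable_funTS.
- exists [set t0]; split => //; first exact: lebesgue_measure_set1.
  move=> t /=; apply: contra_notP => /eqP tt0 _.
  by rewrite fg.
Qed.

Section Parts.
(** Stands for the real or the imaginary part, so that both components of [cint] are treated by the
    same lemmas. *)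
Variable part : C -> R.
Hypothesis partD : forall x y, part (x + y) = part x + part y.
Hypothesis partM : forall x (t : R), part (x * t%:C) = part x * t.

Let part0 : part 0 = 0.
Proof. by rewrite -(mulr0 0) (partM 0 0) mulr0. Qed.

Definition poly_part (p : {poly C}) : {poly R} :=
  \poly_(i < size p) part p`_i.

Lemma coef_poly_part p i : (poly_part p)`_i = part p`_i.
Proof. by rewrite coef_poly; case: ltnP => // pi; rewrite nth_default ?part0. Qed.

Lemma horner_poly_part p (t : R) : (poly_part p).[t] = part p.[t%:C].
Proof.
rewrite (horner_coef_wide _ (size_poly _ _)) horner_coef (big_morph _ partD part0).
by apply: eq_bigr => i _; rewrite coef_poly_part -rmorphXn partM.
Qed.

Lemma antideriv_poly_part p :
  antideriv (poly_part p) = poly_part (antideriv p).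
Proof.
apply/polyP => i; rewrite coef_poly_part !coef_antideriv coef_poly_part.
by rewrite -partM fmorphV rmorph_nat.
Qed.

Lemma pint_poly_part p : pint (poly_part p) 0 1 = part (pint p 0 1).
Proof.
rewrite /pint antideriv_poly_part !horner_poly_part rmorph1 rmorph0.
set x := _.[1]; set y := _.[0].
have := partD (x - y) y; rewrite subrK => ->; ring.
Qed.

End Parts.

Lemma cint_horner (p : {poly C}) (f : C -> C) (a u v : C) :
  (forall w, w != a -> f w = p.[w]) -> cint f u v = pint p u v.
Proof.
move=> fp.
pose l : {poly C} := u%:P + 'X * (v - u)%:P.
pose g : {poly C} := (p \Po l) * (v - u)%:P.
have lE t : l.[t] = u + t * (v - u) by rewrite !hornerE.
have -> : pint p u v = pint g 0 1.
  have -> : g = (antideriv p \Po l)^`().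
    rewrite deriv_comp deriv_antideriv /g; congr (_ * _).
    rewrite /l derivD derivC add0r derivM derivX derivC mulr0 addr0 mul1r //.
  by rewrite pint_deriv !horner_comp !lE mul0r addr0 mul1r subrKC.
(* On a degenerate segment every parameter may be exceptional, but the factor [v - u] makes both
   sides vanish. *)
have [uv|uv] := eqVneq u v.
  have g0 : g = 0 by rewrite /g uv subrr polyC0 mulr0.
  rewrite /cint g0 pint0 uv subrr.
  have := Rintegral_horner 0; rewrite pint0 => H.
  apply/eqP; rewrite eq_complex /=; apply/andP; split; apply/eqP.
    by rewrite -[RHS]H; apply: eq_Rintegral => t _; rewrite mulr0 horner0.
  by rewrite -[RHS]H; apply: eq_Rintegral => t _; rewrite mulr0 horner0.
have vu0 : v - u != 0 by rewrite subr_eq0 eq_sym.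
(* The only real parameter at which the segment can meet [a]; if the quotient is not real, [a] is
   never met and excluding [t0] is harmless. *)
pose t0 := complex.Re ((a - u) / (v - u)).
have ft (t : R) : t != t0 -> f (u + t%:C * (v - u)) * (v - u) = g.[t%:C].
  move=> tt0; rewrite fp; first by rewrite !hornerE horner_comp lE.
  apply: contra_neq tt0 => tE; rewrite /t0 -tE addrAC subrr add0r mulfK //.
have mg (q : {poly R}) : measurable_fun setT (horner q).
  by apply: continuous_measurable_fun; apply: continuous_horner.
rewrite /cint; apply/eqP; rewrite eq_complex /=; apply/andP; split; apply/eqP.
  rewrite -(pint_poly_part _ cReD cReMr) -Rintegral_horner.
  apply: (@Rintegral_eq_off_point _ _ t0); first exact: mg.
  by move=> t tt0; rewrite (horner_poly_part _ cReD cReMr) ft.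
rewrite -(pint_poly_part _ cImD cImMr) -Rintegral_horner.
apply: (@Rintegral_eq_off_point _ _ t0); first exact: mg.
by move=> t tt0; rewrite (horner_poly_part _ cImD cImMr) ft.
Qed.

End SegmentIntegral.

(** * Derivatives of the root functions *)

Section NearestRoot.
Context {K : numFieldType}.

(** The nearest root gives the smallest factor, whose power is at most the product of all the
    factors. This estimate yields both the root functions and the continuity of roots. *)
Lemma exists_near_root (s : seq K) (x : K) : s != [::] ->
  exists2 r, r \in s & `|x - r| ^+ size s <= `|\prod_(r <- s) (x - r)|.
Proof.
elim: s => // a s IH _.
have [->|/IH [r rs rle]] := eqVneq s [::].
  by exists a; rewrite ?mem_head // big_seq1.
rewrite big_cons normrM [size (a :: s)]/=.
have := real_leP (normr_real (x - a)) (normr_real (x - r)).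
case=> [ar|/ltW ra].
  exists a; rewrite ?mem_head // exprS ler_wpM2l //.
  by rewrite (le_trans _ rle) // lerXn2r // nnegrE.
exists r; first by rewrite inE rs orbT.
by rewrite exprS ler_pM // exprn_ge0.
Qed.

Lemma tendsto_root_expr {T : Type} {F : set_system T} {FF : Filter F}
    (u : T -> K) n : (0 < n)%N ->
  islittleo (F := F) (fun=> 1) (fun t => u t ^+ n) ->
  islittleo (F := F) (fun=> 1) u.
Proof.
move=> n0 uo e e0; have := uo _ (exprn_gt0 n e0).
apply: filterS => t; rewrite normr1 !mulr1 normrX.
by rewrite ler_pXn2r // nnegrE // ltW.
Qed.

End NearestRoot.

Section RootFunctionDerivative.
Context {R : realType}.
Local Notation C := R[i].

Lemma tendsto_cvg {T : Type} {F : set_system T} {FF : Filter F}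
  (u : T -> C) (l : C) : tendsto (F := F) u l <-> u @ F --> l.
Proof.
split=> [/tendstoP ul|/cvgrPdist_le ul].
  by apply/cvgrPdist_le => e e0; apply: filterS (ul _ e0) => t; rewrite distrC.
by apply/tendstoP => e e0; apply: filterS (ul _ e0) => t; rewrite distrC.
Qed.

Definition param_poly {q : nat} (p : C * 'rV[C]_q) : {poly C} :=
  \prod_(j < q) ('X - (p.2 0 j)%:P).

Lemma size_param_poly q (p : C * 'rV[C]_q) : size (param_poly p) = q.+1.
Proof. by rewrite size_prod_XsubC /index_enum -enumT size_enum_ord. Qed.

Lemma primitiveE q (p : C * 'rV[C]_q) z :
  primitive p z = pint (param_poly p) p.1 z.
Proof.
apply: (@cint_horner _ _ _ 0) => w _.
by rewrite horner_prod; apply: eq_bigr => j _; rewrite hornerXsubC.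
Qed.

Lemma near_param_poly {q} (p0 : C * 'rV[C]_q) :
  ptendsto (F := nbhs p0) param_poly (param_poly p0).
Proof.
apply: ptendsto_prod => j _; apply: ptendsto_XsubC; apply/tendsto_cvg.
apply: (@continuous_comp _ _ _ snd (fun M : 'rV[C]_q => M 0 j)).
  exact: cvg_snd.
exact: coord_continuous.
Qed.

(** [Z p] is a root provided by [exists_near_root] around [z0]: its distance to [z0], raised to the
    power [q.+1], is bounded by a multiple of [primitive p z0], which tends to 0 at [p0]. *)
Lemma exists_root_function q (p0 : C * 'rV[C]_q) (z0 : C) :
  primitive p0 z0 = 0 -> exists Z, is_root_function p0 z0 Z.
Proof.
move=> pz0.
pose A (p : C * 'rV[C]_q) :=
  antideriv (param_poly p) - ((antideriv (param_poly p)).[p.1])%:P.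
(* [A p] is the primitive as a polynomial in [z]. Its leading coefficient 1 / (q + 1) explains the
   factor [q.+1%:R] in the bounds below. *)
have AE p z : (A p).[z] = primitive p z by rewrite primitiveE !hornerE.
have cA p : lead_coef (A p) = q.+1%:R^-1 /\ size (A p) = q.+2.
  have cq : (A p)`_q.+1 = q.+1%:R^-1.
    rewrite coefB coefC subr0 coef_antideriv /=.
    have /monicP : param_poly p \is monic by apply: monic_prod_XsubC.
    by rewrite lead_coefE size_param_poly /= => ->; rewrite mul1r.
  have sA : size (A p) = q.+2.
    apply/eqP; rewrite eqn_leq; apply/andP; split.
      rewrite size_polyB_leq //; last by rewrite (leq_trans (size_polyC_leq1 _)).
      by rewrite (leq_trans (size_antideriv _)) // size_param_poly.
    rewrite ltnNge; apply/negP => /leq_sizeP /(_ q.+1 (leqnn _)).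
    by rewrite cq => /eqP; rewrite invr_eq0 pnatr_eq0.
  by rewrite lead_coefE sA.
have zP p : exists r, (A p).[r] = 0 /\
    `|z0 - r| ^+ q.+1 <= `|q.+1%:R * primitive p z0|.
  have [s sE] := closed_field_poly_normal (A p).
  have [lA sA] := cA p.
  have ss : size s = q.+1.
    apply/eqP; rewrite -eqSS -sA sE size_scale ?size_prod_XsubC //.
    by rewrite lA invr_eq0 pnatr_eq0.
  have [|r rs rle] := @exists_near_root _ s z0; first by rewrite -size_eq0 ss.
  exists r; split.
    rewrite sE hornerZ; apply/eqP; rewrite mulf_eq0; apply/orP; right.
    by rewrite -rootE root_prod_XsubC.
  rewrite -{1}ss (le_trans rle) // -AE sE hornerZ lA mulrA mulfV ?pnatr_eq0 //.
  rewrite mul1r horner_prod le_eqVlt; apply/orP; left; apply/eqP; congr (`|_|).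
  by apply: eq_bigr => j _; rewrite hornerXsubC.
pose Z p := sval (cid (zP p)).
have ZP p : (A p).[Z p] = 0 /\
    `|z0 - Z p| ^+ q.+1 <= `|q.+1%:R * primitive p z0|.
  exact: (svalP (cid (zP p))).
have Zp0 : Z p0 = z0.
  have [_] := ZP p0; rewrite pz0 mulr0 normr0 -normrX normr_le0 expf_eq0 /=.
  by rewrite subr_eq0 => /eqP.
exists Z; split => //; last first.
  by apply: (@nearW _ (nbhs p0)) => p; rewrite -AE (ZP p).1.
suff : tendsto (F := nbhs p0) Z z0 by rewrite -{1}Zp0 => /tendsto_cvg.
apply: (@tendsto_root_expr _ _ (nbhs p0) _ _ q.+1) => //.
apply: (@islittleo_le _ _ (nbhs p0) _ _ _ (fun p => q.+1%:R * primitive p z0)).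
  by apply: nearW => p; rewrite normrX distrC; have [] := ZP p.
apply: islittleo_Zl.
have Ap : ptendsto (F := nbhs p0) (fun p => antideriv (param_poly p))
    (antideriv (param_poly p0)).
  apply: ptendsto_antideriv; exact: near_param_poly.
have sAp (p : C * 'rV[C]_q) : (size (antideriv (param_poly p)) <= q.+2)%N.
  by rewrite (leq_trans (size_antideriv _)) // size_param_poly.
have p1 : tendsto (F := nbhs p0) fst p0.1 by apply/tendsto_cvg; exact: cvg_fst.
apply/tendsto0; rewrite -pz0 primitiveE.
apply: (@tendsto_eq _ _ _ _ _ (fun p => (antideriv (param_poly p)).[z0] -
  (antideriv (param_poly p)).[p.1])).
  by apply: nearW => p; rewrite primitiveE.
apply: tendstoB; first exact: ptendsto_horner Ap.
apply: (@islittleo_eqfun _ _ _ _ _ _ (fun p =>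
  ((antideriv (param_poly p)).[p.1] - (antideriv (param_poly p)).[p0.1]) +
  ((antideriv (param_poly p)).[p0.1] - (antideriv (param_poly p0)).[p0.1]))).
  by move=> p; ring.
apply: islittleoD; last exact: ptendsto_horner Ap.
by apply: horner_pbigO_sub p1 => //; exact: ptendsto_bigO Ap.
Qed.

Lemma root_functionP {q} {p0 : C * 'rV[C]_q} {z0 : C} : primitive p0 z0 = 0 ->
  is_root_function p0 z0 (root_function p0 z0).
Proof. by move=> /exists_root_function /(xgetPex (fun=> 0)). Qed.

(** The partial derivatives are taken in directions that change a single parameter; along these the
    polynomial is affine in [h], and [root_expansion] applies with no error in the polynomial. *)
Lemma directional_root_expansion {F : set_system C} {FF : Filter F} q
    (p0 v : C * 'rV[C]_q) (w : C -> C) (z0 : C) (L : {poly C}) :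
  islittleo (F := F) (fun=> 1) id ->
  tendsto (F := F) w z0 ->
  pint (param_poly p0) p0.1 z0 = 0 -> (param_poly p0).[z0] != 0 ->
  (forall h : C, param_poly (h *: v + p0) = param_poly p0 + h *: L) ->
  (\forall h \near F, pint (param_poly (h *: v + p0)) (h * v.1 + p0.1) (w h) = 0) ->
  islittleo (F := F) id (fun h => w h - z0 - h *
    (((param_poly p0).[p0.1] * v.1 - pint L p0.1 z0) / (param_poly p0).[z0])).
Proof.
move=> h0 wz pz0 nz vL near0.
(* The affine formula at h = 1 bounds the size of [L]. *)
have LE : L = param_poly (1 *: v + p0) - param_poly p0.
  by rewrite vL scale1r addrC addKr.
have sL : (size L <= q.+1)%N by rewrite LE size_polyB_leq // size_param_poly.
have hv1 : isbigO (F := F) id (fun h => h * v.1).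
  by apply: isbigO_Mbdr; [exact: isbigO_refl | exact: isbigO1_cst].
apply: (@islittleo_eqfun _ _ _ _ _ _ (fun h => w h - z0 -
    ((param_poly p0).[p0.1] * ((h * v.1 + p0.1) - p0.1) -
     pint (h *: L) p0.1 z0) / (param_poly p0).[z0])).
  by move=> h; rewrite pintZ; ring.
apply: (@root_expansion _ _ F _ q.+1 id (param_poly p0)
  (fun h => param_poly (h *: v + p0)) (fun h => h *: L)
  (fun h => h * v.1 + p0.1)).
- by rewrite size_param_poly.
- by move=> h; rewrite size_param_poly.
- by move=> h; rewrite (leq_trans (size_scale_leq _ _)).
- apply: (@islittleo_eqfun _ _ _ _ _ _ (fun h => h * v.1)).
    by move=> h; rewrite addrK.
  by apply: islittleo_Mbdr; [exact: h0 | exact: isbigO1_cst].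
- exact: wz.
- by apply: isbigO_eqfun hv1 => h; rewrite addrK.
- apply: plittleo_eqfun (plittleo0 _) => h.
  by rewrite vL (addrC (param_poly p0)) addrK subrr.
- by apply: pbigOZ; exact: isbigO_refl.
- exact: nz.
- exact: pz0.
- exact: near0.
Qed.

Lemma difference_quotient_tendsto {F : set_system C} {FF : Filter F}
    (w : C -> C) (z0 l : C) :
  (\forall h \near F, h != 0) ->
  islittleo (F := F) id (fun h => w h - z0 - h * l) ->
  tendsto (F := F) (fun h => h^-1 * (w h - z0)) l.
Proof.
move=> n0 H; apply/tendstoP => e /H; apply: filterS2 n0 => h h0 He.
have -> : h^-1 * (w h - z0) - l = h^-1 * (w h - z0 - h * l).
  by rewrite [in RHS]mulrBr mulKf.
by rewrite normrM normfV ler_pdivrMl ?normr_gt0 // [`|h| * _]mulrC.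
Qed.

(** The root function enters only through its three defining properties, so the arbitrary choice
    made by [xget] does not affect the value. *)
Lemma derive_root_function q (p0 v : C * 'rV[C]_q) (z0 : C) (L : {poly C}) :
  primitive p0 z0 = 0 -> (param_poly p0).[z0] != 0 ->
  (forall h : C, param_poly (h *: v + p0) = param_poly p0 + h *: L) ->
  'D_v (root_function p0 z0) p0 =
    ((param_poly p0).[p0.1] * v.1 - pint L p0.1 z0) / (param_poly p0).[z0].
Proof.
move=> pz0 nz vL.
have [Zp0 Zc Zr] := root_functionP pz0.
set Z := root_function p0 z0 in Zp0 Zc Zr *.
set l := (X in _ = X).
apply: cvg_lim; first exact: norm_hausdorff.
have hp : (fun h : C => h *: v + p0) @ 0^' --> p0.
  rewrite -[X in _ --> X]add0r -[X in X + _](scale0r v).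
  apply: cvgD; last exact: cvg_cst.
  apply: cvgZl; exact: cvg_within.
have hO : islittleo (F := (0 : C)^') (fun=> 1) id.
  by apply/tendsto0/tendsto_cvg; exact: cvg_within.
have n0 : \forall h \near (0 : C)^', h != 0 by exact: withinT.
have wz : tendsto (F := (0 : C)^') (fun h => Z (h *: v + p0)) z0.
  apply/tendsto_cvg; rewrite -Zp0.
  exact: (@cvg_comp _ _ _ (fun h : C => h *: v + p0) Z _ _ _ hp Zc).
have Zr' : \forall h \near (0 : C)^',
    primitive (h *: v + p0) (Z (h *: v + p0)) = 0 by exact: (hp _ Zr).
have pz0' : pint (param_poly p0) p0.1 z0 = 0 by rewrite -primitiveE.
apply/tendsto_cvg.
have H := @directional_root_expansion _ _ _ p0 v _ z0 L hO wz pz0' nz vL.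
have : tendsto (F := (0 : C)^') (fun h => h^-1 * (Z (h *: v + p0) - z0)) l.
  apply: difference_quotient_tendsto n0 _; apply: H.
  by apply: filterS Zr' => h; rewrite primitiveE.
by rewrite -[in X in X -> _]Zp0.
Qed.

End RootFunctionDerivative.

(** * Continuity of roots *)

Section RootContinuity.
Context {K : numFieldType} {T : Type} {F : set_system T} {FF : Filter F}.

(** Synthetic division: the coefficients f_i of the quotient are recovered downwards from f_i = ((X
    - c) f)_(i+1) + c f_(i+1), starting above the common size bound [N], where they vanish. *)
Lemma ptendsto_factor N (r : T -> K) (a : K) (q : T -> {poly K}) (p : {poly K}) :
  (forall t, (size (q t) <= N)%N) -> (size p <= N)%N ->
  tendsto (F := F) r a ->
  ptendsto (F := F) (fun t => ('X - (r t)%:P) * q t) (('X - a%:P) * p) ->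
  ptendsto (F := F) q p.
Proof.
move=> sq sp ra H.
suff E k : forall i, (N <= i + k)%N -> tendsto (F := F) (fun t => (q t)`_i) p`_i.
  by move=> i; apply: (E N); rewrite leq_addl.
elim: k => [|k IH] i.
  rewrite addn0 => Ni; apply: (@tendsto_eq _ _ _ _ _ (fun=> 0)).
    by apply: nearW => t; rewrite nth_default // (leq_trans (sq t)).
  by rewrite [p`_i]nth_default ?(leq_trans sp) //; exact: tendsto_cst.
rewrite addnS -addSn => /IH qi.
have XE (c : K) (f : {poly K}) : (('X - c%:P) * f)`_i.+1 = f`_i - c * f`_i.+1.
  by rewrite mulrBl coefB coefXM coefCM.
have := H i.+1; rewrite XE => Hi.
have -> : p`_i = (p`_i - a * p`_i.+1) + a * p`_i.+1 by rewrite subrK.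
apply: (@tendsto_eq _ _ _ _ _
  (fun t => (('X - (r t)%:P) * q t)`_i.+1 + r t * (q t)`_i.+1)).
  by apply: nearW => t; rewrite XE subrK.
by apply: tendstoD Hi _; apply: tendstoM.
Qed.

(** A root of the moving polynomial close to the first entry of [s] is split off, and the induction
    continues on the quotients, which converge by [ptendsto_factor]. *)
Lemma roots_tendsto (s : seq K) (u : T -> seq K) :
  (forall t, size (u t) = size s) ->
  ptendsto (F := F) (fun t => \prod_(x <- u t) ('X - x%:P))
    (\prod_(x <- s) ('X - x%:P)) ->
  exists v : T -> seq K, (forall t, perm_eq (u t) (v t)) /\
    (forall j, tendsto (F := F) (fun t => (v t)`_j) s`_j).
Proof.
elim: s u => [|a s IH] u su H.
  exists u; split => // j; rewrite nth_nil.
  apply: (@tendsto_eq _ _ _ _ _ (fun=> 0)); last exact: tendsto_cst.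
  by apply: nearW => t; rewrite nth_default // su.
have {}su t : size (u t) = (size s).+1 by exact: su.
have rP t : exists r, r \in u t /\
    `|a - r| ^+ (size s).+1 <= `|(\prod_(x <- u t) ('X - x%:P)).[a]|.
  have [|r ru rle] := exists_near_root (u t) a; first by rewrite -size_eq0 su.
  exists r; split => //; rewrite -(su t) (le_trans rle) //.
  rewrite horner_prod le_eqVlt; apply/orP; left; apply/eqP; congr (`|_|).
  by apply: eq_bigr => j _; rewrite hornerXsubC.
have [r {}rP] := choice rP.
have up t : perm_eq (u t) (r t :: rem (r t) (u t)).
  by apply: perm_to_rem; have [] := rP t.
have sr t : size (rem (r t) (u t)) = size s.
  by apply/eqP; rewrite -eqSS -(su t); rewrite (perm_size (up t)).
have ra : tendsto (F := F) r a.
  apply: (@tendsto_root_expr _ _ F _ _ (size s).+1) => //.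
  apply: (@islittleo_le _ _ F _ _ _ (fun t => (\prod_(x <- u t) ('X - x%:P)).[a])).
    by apply: nearW => t; rewrite normrX distrC; have [] := rP t.
  apply/tendsto0.
  have -> : 0 = (\prod_(x <- a :: s) ('X - x%:P)).[a].
    by rewrite big_cons hornerM hornerXsubC subrr mul0r.
  apply: (@ptendsto_horner _ _ F _ (size s).+2) H => [t|].
    by rewrite size_prod_XsubC su.
  by rewrite size_prod_XsubC.
have [|v [vp vt]] := IH (fun t => rem (r t) (u t)) sr.
  apply: (@ptendsto_factor (size s).+1 r a) => // [t||].
  - by rewrite size_prod_XsubC sr.
  - by rewrite size_prod_XsubC.
  - move=> i; have := H i; rewrite big_cons.
    apply: tendsto_eq; apply: nearW => t.
    by rewrite (perm_big _ (up t)) /= big_cons.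
exists (fun t => r t :: v t); split => [t|[|j]]; last exact: vt.
  by rewrite (perm_trans (up t)) // perm_cons.
exact: ra.
Qed.

End RootContinuity.

(** * Multiplication of roots and critical points by a constant *)

Section Scaling.
Context {K : numFieldType}.

Lemma prod_XsubC_scale (c : K) (s : seq K) :
  (\prod_(x <- [seq c * x | x <- s]) ('X - x%:P)) \Po (c *: 'X) =
  c ^+ size s *: \prod_(x <- s) ('X - x%:P).
Proof.
elim: s => [|x s IH]; first by rewrite !big_nil comp_polyC scale1r.
rewrite /= !big_cons comp_polyM IH comp_polyB comp_polyX comp_polyC.
rewrite exprS polyCM -!mul_polyC polyCM; ring.
Qed.

Lemma pint_scale (c : K) (p : {poly K}) u v :
  pint p (c * u) (c * v) = c * pint (p \Po (c *: 'X)) u v.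
Proof.
have E : c *: (p \Po (c *: 'X)) = (antideriv p \Po (c *: 'X))^`().
  by rewrite deriv_comp deriv_antideriv derivZ derivX alg_polyC mulrC mul_polyC.
by rewrite -pintZ E pint_deriv !horner_comp !hornerZ !hornerX.
Qed.

Lemma pint_prod_XsubC_scale (c : K) (s : seq K) u v :
  pint (\prod_(x <- s) ('X - x%:P)) u v = 0 ->
  pint (\prod_(x <- [seq c * x | x <- s]) ('X - x%:P)) (c * u) (c * v) = 0.
Proof. by move=> H; rewrite pint_scale prod_XsubC_scale pintZ H !mulr0. Qed.

End Scaling.

(** * Closed forms of the partial derivatives of a root *)

Section Partials.
Variable R : realType.
Local Notation C := R[i].

Lemma param_polyE (beta : C) (zeta : seq C) :
  param_poly (param beta zeta) = \prod_(x <- zeta) ('X - x%:P).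
Proof.
rewrite (big_nth 0) big_mkord; apply: eq_bigr => j _.
by rewrite mxE.
Qed.

Lemma dz_dbetaE (beta : C) (zeta : seq C) (z0 : C) :
  let p := \prod_(x <- zeta) ('X - x%:P) in
  pint p beta z0 = 0 -> p.[z0] != 0 ->
  dz_dbeta beta zeta z0 = p.[beta] / p.[z0].
Proof.
move=> p; rewrite /p -(param_polyE beta) => pz0 nz.
rewrite /dz_dbeta (@derive_root_function _ _ _ _ _ 0) //.
- by rewrite pint0 subr0 mulr1.
- by rewrite primitiveE.
- move=> h; rewrite scaler0 addr0; apply: eq_bigr => j _.
  by rewrite /= scaler0 add0r.
Qed.

(** Moving zeta_j by [h] changes the product by [- h *: M], where [M] is the product of the other
    factors. Characterizing [M] by a multiplication lets each use supply its own factored form. *)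
Lemma dz_dzetaE (beta : C) (zeta : seq C) (z0 : C) (j : nat) (M : {poly C}) :
  let p := \prod_(x <- zeta) ('X - x%:P) in
  (j < size zeta)%N -> ('X - (zeta`_j)%:P) * M = p ->
  pint p beta z0 = 0 -> p.[z0] != 0 ->
  dz_dzeta beta zeta z0 j = pint M beta z0 / p.[z0].
Proof.
move=> p jz MP; rewrite /p -(param_polyE beta) => pz0 nz.
rewrite /dz_dzeta (@derive_root_function _ _ _ _ _ (- M)) //.
- by rewrite pintN mulr0 sub0r opprK.
- by rewrite primitiveE.
move=> h; rewrite [in RHS]param_polyE -/p -MP.
pose oj := Ordinal jz.
have pj : 'X - (zeta`_j)%:P != 0 by rewrite polyXsubC_eq0.
rewrite /param_poly (bigD1 oj) //=.
have -> : \prod_(i < size zeta | i != oj) ('X - ((h *: (\row_l (l == j :> nat)%:R)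
    + \row_(k < size zeta) zeta`_k) 0 i)%:P) = M.
  apply: (mulfI pj); rewrite MP /p -(param_polyE beta) /param_poly [RHS](bigD1 oj) //=.
  rewrite !mxE /=; congr (_ * _); apply: eq_bigr => i ij.
  rewrite !mxE; have -> : (i == j :> nat) = false by apply/negbTE.
  by rewrite mulr0 add0r.
rewrite !mxE /= eqxx mulr1 polyCD -mul_polyC; ring.
Qed.

End Partials.

(** * Real and imaginary parts of O and o *)

Local Notation normc := ComplexField.Normc.normc.

Section ComplexLandau.
Context {R : realType} {T : Type} {F : set_system T} {FF : Filter F}.
Local Notation C := R[i].
Implicit Types (D f : T -> R) (u : T -> C).

Lemma normcEC (z : C) : `|z| = (normc z)%:C.
Proof. by []. Qed.

Lemma normc_sqr (z : C) : normc z ^+ 2 = complex.Re z ^+ 2 + complex.Im z ^+ 2.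
Proof. by case: z => x y; rewrite /= sqr_sqrtr // addr_ge0 // sqr_ge0. Qed.

Lemma normc_ge0 (z : C) : 0 <= normc z.
Proof. by case: z => x y; rewrite sqrtr_ge0. Qed.

Lemma norm_real_complex (x : R) : `|x%:C| = `|x|%:C.
Proof. by rewrite normcEC /= expr0n addr0 sqrtr_sqr. Qed.

Lemma norm_Re_le (z : C) : `|complex.Re z| <= normc z.
Proof. by rewrite -lecR; apply: normc_ge_Re. Qed.

Lemma norm_Im_le (z : C) : `|complex.Im z| <= normc z.
Proof.
rewrite -(@ler_pXn2r _ 2) ?nnegrE ?normc_ge0 // normc_sqr real_normK ?num_real //.
by rewrite lerDr sqr_ge0.
Qed.

Lemma posc_Re (e : C) : 0 < e -> 0 < complex.Re e /\ e = (complex.Re e)%:C.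
Proof. by case: e => x y; rewrite ltcE /= => /andP[/eqP -> ?]. Qed.

Lemma isbigO_real_complex D f : isbigO (F := F) D f ->
  isbigO (F := F) (fun t => (D t)%:C) (fun t => (f t)%:C).
Proof.
move=> [M M0 fM]; exists M%:C; first by rewrite ltcR.
by apply: filterS fM => t; rewrite !norm_real_complex -rmorphM lecR.
Qed.

Lemma islittleo_real_complex D f : islittleo (F := F) D f ->
  islittleo (F := F) (fun t => (D t)%:C) (fun t => (f t)%:C).
Proof.
move=> fo e /posc_Re[e0 ->]; apply: filterS (fo _ e0) => t.
by rewrite !norm_real_complex -rmorphM lecR.
Qed.

Lemma isbigO_complex D u : isbigO (F := F) D (fun t => complex.Re (u t)) ->
  isbigO (F := F) D (fun t => complex.Im (u t)) ->
  isbigO (F := F) (fun t => (D t)%:C) u.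
Proof.
move=> /isbigO_real_complex ReO /isbigO_real_complex ImO.
apply: (@isbigO_eqfun _ _ _ _ _ _
  (fun t => (complex.Re (u t))%:C + 'i%C * (complex.Im (u t))%:C)).
  by move=> t; rewrite -complexE.
by apply: isbigOD; [exact: ReO | apply: isbigO_Zl; exact: ImO].
Qed.

Lemma islittleo_Re D u : islittleo (F := F) (fun t => (D t)%:C) u ->
  islittleo (F := F) D (fun t => complex.Re (u t)).
Proof.
move=> uo e e0; have ec0 : 0 < e%:C by rewrite ltcR.
apply: filterS (uo _ ec0) => t; rewrite norm_real_complex -rmorphM normcEC lecR.
exact: le_trans (norm_Re_le _).
Qed.

Lemma islittleo_Im D u : islittleo (F := F) (fun t => (D t)%:C) u ->
  islittleo (F := F) D (fun t => complex.Im (u t)).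
Proof.
move=> uo e e0; have ec0 : 0 < e%:C by rewrite ltcR.
apply: filterS (uo _ ec0) => t; rewrite norm_real_complex -rmorphM normcEC lecR.
exact: le_trans (norm_Im_le _).
Qed.

(** One-sided, because the extremality conditions only give upper bounds; sums with positive
    weights, such as the one in property G, preserve it. *)
Definition isuplittleo D f := forall e : R, 0 < e ->
  \forall t \near F, f t <= e * `|D t|.

Lemma isuplittleo_le D f g : (\forall t \near F, f t <= g t) ->
  isuplittleo D g -> isuplittleo D f.
Proof.
by move=> fg go e /go; apply: filterS2 fg => t; apply: le_trans.
Qed.

Lemma islittleo_up D f : islittleo (F := F) D f -> isuplittleo D f.
Proof.
move=> fo e /fo; apply: filterS => t; apply: le_trans; exact: ler_norm.
Qed.

Lemma isuplittleo_littleo D f : isuplittleo D f ->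
  isuplittleo D (fun t => - f t) -> islittleo (F := F) D f.
Proof.
move=> fo gn e e0; apply: filterS2 (fo _ e0) (gn _ e0) => t ft gt.
by rewrite ler_norml ft andbT lerNl.
Qed.

Lemma isuplittleoD D f g : isuplittleo D f -> isuplittleo D g ->
  isuplittleo D (fun t => f t + g t).
Proof.
move=> uo vo e e0; have e20 : 0 < e / 2 by rewrite divr_gt0.
apply: filterS2 (uo _ e20) (vo _ e20) => t ut vt.
by rewrite [e]splitr mulrDl lerD.
Qed.

Lemma isuplittleo_Zl D f c : 0 < c -> isuplittleo D f ->
  isuplittleo D (fun t => c * f t).
Proof.
move=> c0 fo e e0; have ec0 : 0 < e / c by rewrite divr_gt0.
apply: filterS (fo _ ec0) => t ft.
by rewrite mulrC -ler_pdivlMr // mulrAC.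
Qed.

Lemma isuplittleo_sum (I : Type) (r : seq I) (P : pred I) D (f : I -> T -> R) :
  (forall i, P i -> isuplittleo D (f i)) ->
  isuplittleo D (fun t => \sum_(i <- r | P i) f i t).
Proof.
move=> fo; elim: r => [|i r IH].
  apply: islittleo_up; apply: islittleo_eqfun (islittleo0 _) => t.
  by rewrite big_nil.
have [Pi|Pi] := boolP (P i).
  apply: isuplittleo_le (isuplittleoD _ _ _ (fo i Pi) IH).
  by apply: nearW => t; rewrite big_cons Pi.
apply: isuplittleo_le IH.
by apply: nearW => t; rewrite big_cons (negbTE Pi).
Qed.

Lemma near_all (I : eqType) (r : seq I) (Q : I -> T -> Prop) :
  (forall i, i \in r -> \forall t \near F, Q i t) ->
  \forall t \near F, forall i, i \in r -> Q i t.
Proof.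
elim: r => [_|i r IH H]; first exact: nearW.
have Hr : \forall t \near F, forall i, i \in r -> Q i t.
  by apply: IH => j jr; apply: H; rewrite inE jr orbT.
have Hi : \forall t \near F, Q i t by apply: H; rewrite mem_head.
apply: filterS2 Hi Hr => t Qi Qr j.
by rewrite inE => /orP[/eqP ->|/Qr].
Qed.

End ComplexLandau.
Arguments isuplittleo {R T} F D f.

(** * Perturbations increasing the distance to the critical points *)

Section Perturbation.
Variable R : realType.
Local Notation C := R[i].
Variables (N m : nat) (beta a : R) (P : {poly C}) (z zeta : seq C) (lambda : C).
Local Notation n := N.+4.+1.
Local Notation rho := (beta - a).
Let p : {poly C} := \prod_(x <- zeta) ('X - x%:P).

Hypothesis zeta_size : size zeta = N.+4.
Hypothesis zeta_a : forall j, (2 <= j < N.+4)%N -> zeta`_j = a%:C.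
Hypothesis a_beta : a < beta.
Hypothesis zeta_dist : forall j, (j < N.+4)%N ->
  normc (zeta`_j - beta%:C) = rho.
Hypothesis z_norm : forall i, (i < m)%N -> `|z`_i| = 1.
Hypothesis z_simple : forall i, (i < m)%N -> p.[z`_i] != 0.
Hypothesis z_root : forall i, (i < m)%N -> pint p beta%:C z`_i = 0.
Hypothesis lambda_neq0 : lambda != 0.
Hypothesis P_deriv : P^`() = lambda *: p.
Hypothesis hG : propG n P beta a z zeta m.
Hypothesis hH : propH n beta a z zeta m.

Context {T : Type} {F : set_system T} {FF : ProperFilter F}.
(* b, t and w are the root near beta, the critical points and the roots near
   the unit circle of the perturbed polynomial; t is extended by 0, the default
   value of the entries of zeta. *)
Variables (b : T -> R) (t : T -> nat -> C) (w : T -> nat -> C).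
Hypothesis b_lim : tendsto (F := F) b beta.
Hypothesis t_lim : forall j, tendsto (F := F) (fun x => t x j) zeta`_j.
Hypothesis t_default : forall x j, (N.+4 <= j)%N -> t x j = 0.
Hypothesis w_lim : forall i, (i < m)%N -> tendsto (F := F) (fun x => w x i) z`_i.
Hypothesis w_disk : forall i, (i < m)%N -> \forall x \near F, `|w x i| <= 1.
Hypothesis w_root : forall i, (i < m)%N -> \forall x \near F,
  pint (\prod_(0 <= j < N.+4) ('X - (t x j)%:P)) (b x)%:C (w x i) = 0.
Hypothesis t_far : forall j, (j < N.+4)%N -> \forall x \near F,
  rho < normc (t x j - (b x)%:C).

Let rho_gt0 : 0 < rho. Proof. by rewrite subr_gt0. Qed.
Let rho_ge0 : 0 <= rho. Proof. exact: ltW rho_gt0. Qed.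

Definition delta_beta (x : T) : R := b x - beta.
Definition delta_zeta (j : nat) (x : T) : C := t x j - zeta`_j.
Definition delta_sum (x : T) : C := \sum_(2 <= j < N.+4) delta_zeta j x.
Definition im_sqr_sum (x : T) : R :=
  \sum_(2 <= j < N.+4) complex.Im (delta_zeta j x) ^+ 2.

Local Notation db := delta_beta.
Local Notation d := delta_zeta.
Local Notation dS := delta_sum.
Local Notation s2 := im_sqr_sum.

(* The quantity D of the header, by which all error terms are measured. *)
Definition gauge (x : T) : R :=
  `|db x| + `|complex.Re (d 0 x)| + `|complex.Im (d 0 x)|
  + `|complex.Re (d 1 x)| + `|complex.Im (d 1 x)|
  + `|complex.Re (dS x)| + `|complex.Im (dS x)| + s2 x.
Local Notation D := gauge.
Local Notation DC := (fun x => (gauge x)%:C).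
Local Notation C1 := (fun=> 1 : C).
Local Notation R1 := (fun=> 1 : R).

(** * Control of the individual increments by the gauge *)

Lemma s2_ge0 x : 0 <= s2 x.
Proof. by apply: sumr_ge0 => j _; apply: sqr_ge0. Qed.

Lemma gauge_bounds x :
  [/\ `|db x| <= D x, `|complex.Re (d 0 x)| <= D x &
   `|complex.Im (d 0 x)| <= D x] /\
  [/\ `|complex.Re (d 1 x)| <= D x, `|complex.Im (d 1 x)| <= D x,
   `|complex.Re (dS x)| <= D x, `|complex.Im (dS x)| <= D x & s2 x <= D x].
Proof.
have := s2_ge0 x; have := normr_ge0 (db x).
have := normr_ge0 (complex.Re (d 0 x)); have := normr_ge0 (complex.Im (d 0 x)).
have := normr_ge0 (complex.Re (d 1 x)); have := normr_ge0 (complex.Im (d 1 x)).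
have := normr_ge0 (complex.Re (dS x)); have := normr_ge0 (complex.Im (dS x)).
by rewrite /gauge; move=> *; split; split; lra.
Qed.

Lemma gauge_ge0 x : 0 <= D x.
Proof. by have [[+ _ _] _] := gauge_bounds x; apply: le_trans. Qed.

Lemma gauge_bigO (f : T -> R) : (forall x, `|f x| <= D x) -> isbigO (F := F) D f.
Proof.
move=> fD; apply: isbigO_le (isbigO_refl D); apply: nearW => x.
by rewrite (ger0_norm (gauge_ge0 x)).
Qed.

Lemma db_bigO : isbigO (F := F) D db.
Proof. by apply: gauge_bigO => x; have [[]] := gauge_bounds x. Qed.

Lemma s2_bigO : isbigO (F := F) D s2.
Proof.
apply: gauge_bigO => x; rewrite ger0_norm ?s2_ge0 //.
by have [_ []] := gauge_bounds x.
Qed.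

Lemma ReS_bigO : isbigO (F := F) D (fun x => complex.Re (dS x)).
Proof. by apply: gauge_bigO => x; have [_ []] := gauge_bounds x. Qed.

Lemma ImS_bigO : isbigO (F := F) D (fun x => complex.Im (dS x)).
Proof. by apply: gauge_bigO => x; have [_ []] := gauge_bounds x. Qed.

Lemma db_o1 : islittleo (F := F) R1 db.
Proof. exact: b_lim. Qed.

Lemma d_o1 j : islittleo (F := F) C1 (d j).
Proof. exact: t_lim. Qed.

Lemma Re_o1 j : islittleo (F := F) R1 (fun x => complex.Re (d j x)).
Proof. exact: (islittleo_Re R1 _ (d_o1 j)). Qed.

Lemma Im_o1 j : islittleo (F := F) R1 (fun x => complex.Im (d j x)).
Proof. exact: (islittleo_Im R1 _ (d_o1 j)). Qed.

Lemma Im_sqr_le j x : (2 <= j < N.+4)%N -> complex.Im (d j x) ^+ 2 <= s2 x.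
Proof.
move=> jN; rewrite /im_sqr_sum (bigD1_seq j) ?mem_index_iota ?iota_uniq //=.
by rewrite lerDl sumr_ge0 // => i _; apply: sqr_ge0.
Qed.

Lemma d_default j x : (N.+4 <= j)%N -> d j x = 0.
Proof.
by move=> jN; rewrite /delta_zeta t_default // nth_default ?zeta_size // subrr.
Qed.

(* Writing x_j = Re d_j - db, the inequality |t_j - b| > rho reads
   2 rho x_j < x_j^2 + y_j^2 with y_j = Im d_j. *)
Lemma far_ineq j : (2 <= j < N.+4)%N -> \forall x \near F,
  2 * rho * (complex.Re (d j x) - db x) <
  (complex.Re (d j x) - db x) ^+ 2 + complex.Im (d j x) ^+ 2.
Proof.
move=> jN; have /andP[_ jN4] := jN.
apply: filterS (t_far _ jN4) => x rt.
have : rho ^+ 2 < normc (t x j - (b x)%:C) ^+ 2.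
  by rewrite ltr_pXn2r // nnegrE ?normc_ge0 // rho_ge0.
rewrite normc_sqr.
have -> : t x j - (b x)%:C = d j x + (a - b x)%:C.
  by rewrite /delta_zeta zeta_a // rmorphB /= addrA subrK.
rewrite cReD cImD /= addr0 /delta_beta; lra.
Qed.

(** Since x_j tends to 0, a positive x_j has x_j^2 <= rho x_j, which absorbs half of the left side
    of [far_ineq] and leaves rho x_j < y_j^2 <= s2. *)
Lemma far_bound j : (2 <= j < N.+4)%N -> \forall x \near F,
  complex.Re (d j x) - db x <= s2 x / rho.
Proof.
move=> jN.
have xo : islittleo (F := F) R1 (fun x => complex.Re (d j x) - db x).
  by apply: islittleoB; [exact: Re_o1 | exact: db_o1].
apply: filterS2 (far_ineq _ jN) (xo _ rho_gt0) => x far.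
rewrite normr1 mulr1 ler_norml => /andP[_ xr].
have y2 := Im_sqr_le _ x jN.
move: far xr y2; set X := complex.Re _ - _; set Y := complex.Im _ ^+ 2; move=> far xr y2.
rewrite ler_pdivlMr //.
have [X0|X0] := leP X 0.
  by apply: (le_trans _ (s2_ge0 x)); apply: mulr_le0_ge0 => //; exact: rho_ge0.
have : X ^+ 2 <= rho * X by rewrite expr2 ler_pM2r.
lra.
Qed.

Lemma sum_xj x : \sum_(2 <= j < N.+4) (complex.Re (d j x) - db x) =
  complex.Re (dS x) - N.+2%:R * db x.
Proof.
rewrite sumrB /delta_sum Re_sum; congr (_ - _).
by rewrite sumr_const_nat subn2 mulr_natl.
Qed.

(** The x_j are not among the variables, but each is bounded above by [far_bound] and their sum is
    O(D): the sum minus the upper bounds of the others bounds each from below. *)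
Lemma xj_bigO j : (2 <= j < N.+4)%N ->
  isbigO (F := F) D (fun x => complex.Re (d j x) - db x).
Proof.
move=> jN.
(* The lower bound takes [N.+2] copies of s2 / rho and the upper bound one; [N.+3] covers both. *)
pose B x := `|complex.Re (dS x)| + N.+2%:R * `|db x| + N.+3%:R * (s2 x / rho).
have BO : isbigO (F := F) D B.
  apply: isbigOD; first apply: isbigOD.
  - by apply: isbigO_le ReS_bigO; apply: nearW => x; rewrite normr_id.
  - apply: isbigO_Zl; apply: isbigO_le db_bigO.
    by apply: nearW => x; rewrite normr_id.
  - apply: isbigO_Zl; apply: isbigO_Mbdr; [exact: s2_bigO | exact: isbigO1_cst].
apply: isbigO_le BO.
have all_far : \forall x \near F, forall i, i \in index_iota 2 N.+4 ->
    complex.Re (d i x) - db x <= s2 x / rho.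
  by apply: near_all => i; rewrite mem_index_iota; apply: far_bound.
apply: filterS all_far => x far.
have s20 : 0 <= s2 x / rho by rewrite divr_ge0 ?s2_ge0 ?rho_ge0.
have NS : 0 <= N.+2%:R * `|db x| by rewrite mulr_ge0.
have NR : N.+3%:R * (s2 x / rho) = N.+2%:R * (s2 x / rho) + s2 x / rho.
  by rewrite -[N.+3]addn1 natrD mulrDl mul1r.
have NP : 0 <= N.+2%:R * (s2 x / rho) by rewrite mulr_ge0.
have B0 : 0 <= B x by rewrite /B NR; have := normr_ge0 (complex.Re (dS x)); lra.
rewrite (ger0_norm B0) ler_norml; apply/andP; split; last first.
  rewrite (le_trans (far j _)) ?mem_index_iota // /B NR.
  by have := normr_ge0 (complex.Re (dS x)); lra.
have := sum_xj x; rewrite (bigD1_seq j) ?mem_index_iota ?iota_uniq //=.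
set rest := \sum_(_ <- _ | _) _ => E.
have restle : rest <= N.+2%:R * (s2 x / rho).
  have -> : N.+2%:R * (s2 x / rho) = \sum_(2 <= i < N.+4) (s2 x / rho).
    by rewrite sumr_const_nat subn2 mulr_natl.
  rewrite [leRHS](bigD1_seq j) ?mem_index_iota ?iota_uniq //=.
  rewrite (le_trans _ (lerD s20 (lexx _))) // add0r.
  rewrite /rest big_seq_cond [leRHS]big_seq_cond; apply: ler_sum => i /andP[iN _].
  exact: far.
have h1 : - `|complex.Re (dS x)| <= complex.Re (dS x).
  by rewrite lerNl; have := ler_norm (- complex.Re (dS x)); rewrite normrN.
have h2 : N.+2%:R * db x <= N.+2%:R * `|db x| by rewrite ler_wpM2l // ler_norm.
rewrite /B NR; lra.
Qed.

Lemma Re_bigO j : isbigO (F := F) D (fun x => complex.Re (d j x)).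
Proof.
have [jN|jN] := leqP N.+4 j.
  by apply: isbigO_eqfun (isbigO0 _) => x; rewrite d_default.
case: j jN => [|[|j]] jN.
- by apply: gauge_bigO => x; have [[]] := gauge_bounds x.
- by apply: gauge_bigO => x; have [_ []] := gauge_bounds x.
apply: isbigO_eqfun (isbigOD _ _ _ (xj_bigO j.+2 jN) db_bigO) => x.
by rewrite subrK.
Qed.

(** For j < 2 the imaginary part is itself O(D) and tends to 0; for the other indices only its
    square is controlled, by [s2]. *)
Lemma Im_sqr_bigO j : isbigO (F := F) D (fun x => complex.Im (d j x) ^+ 2).
Proof.
have [jN|jN] := leqP N.+4 j.
  by apply: isbigO_eqfun (isbigO0 _) => x; rewrite d_default //= expr0n.
case: j jN => [|[|j]] jN.
- apply: (@isbigO_eqfun _ _ _ _ _ _ (fun x => complex.Im (d 0 x) * complex.Im (d 0 x))).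
    by move=> x; rewrite expr2.
  apply: islittleo_bigO; apply: islittleo_Mol; first exact: Im_o1.
  by apply: gauge_bigO => x; have [[]] := gauge_bounds x.
- apply: (@isbigO_eqfun _ _ _ _ _ _ (fun x => complex.Im (d 1 x) * complex.Im (d 1 x))).
    by move=> x; rewrite expr2.
  apply: islittleo_bigO; apply: islittleo_Mol; first exact: Im_o1.
  by apply: gauge_bigO => x; have [_ []] := gauge_bounds x.
apply: isbigO_le s2_bigO; apply: nearW => x.
by rewrite !ger0_norm ?s2_ge0 ?sqr_ge0 // Im_sqr_le.
Qed.

Lemma ImM_bigO j l : isbigO (F := F) D (fun x => complex.Im (d j x) * complex.Im (d l x)).
Proof.
apply: isbigO_le (isbigOD _ _ _ (Im_sqr_bigO j) (Im_sqr_bigO l)).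
apply: nearW => x; rewrite [leRHS]ger0_norm ?addr_ge0 ?sqr_ge0 //.
set u := complex.Im _; set v := complex.Im _.
have := sqr_ge0 (u - v); have := sqr_ge0 (u + v).
by move=> h1 h2; rewrite ler_norml; apply/andP; split; nra.
Qed.

(** Products with a real part are even o(D), a real part being O(D) and the other factor o(1); the
    product of the imaginary parts is what limits the bound to O(D). *)
Lemma dd_bigO j l : isbigO (F := F) DC (fun x => d j x * d l x).
Proof.
apply: isbigO_complex.
  apply: (@isbigO_eqfun _ _ _ _ _ _ (fun x =>
     complex.Re (d j x) * complex.Re (d l x) - complex.Im (d j x) * complex.Im (d l x))).
    by move=> x; rewrite cReM.
  apply: isbigOB; last exact: ImM_bigO.
  by apply: islittleo_bigO; apply: islittleo_Mol; [exact: Re_o1 | exact: Re_bigO].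
apply: (@isbigO_eqfun _ _ _ _ _ _ (fun x =>
   complex.Re (d j x) * complex.Im (d l x) + complex.Im (d j x) * complex.Re (d l x))).
  by move=> x; rewrite cImM.
apply: isbigOD; apply: islittleo_bigO.
  by apply: islittleo_Mor; [exact: Re_bigO | exact: Im_o1].
by apply: islittleo_Mol; [exact: Im_o1 | exact: Re_bigO].
Qed.

(** * The inequalities at the critical points *)

Local Notation Ek k := (fun x => E n beta a z zeta (db x) (d 0 x) (d 1 x) (dS x) k).
Local Notation Fk k := (fun x => Defs.F P beta a z (s2 x) k).

(** For u = (d_k - db) / (zeta_k - beta), the distance condition says |1 + u| > 1, that is - Re u <
    |u|^2 / 2, and |u|^2 is o(D) because u is both O(D) and o(1). *)
Lemma near_crit_up (k : nat) : (k < 2)%N ->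
  isuplittleo F D (fun x =>
    - complex.Re ((d k x - (db x)%:C) / (zeta`_k - beta%:C))).
Proof.
move=> k2; have kN : (k < N.+4)%N by rewrite (leq_trans k2).
have nk : normc (zeta`_k - beta%:C) = rho by exact: zeta_dist.
have zk0 : zeta`_k - beta%:C != 0.
  apply: contraTneq rho_gt0 => z0; rewrite -nk z0 ComplexField.Normc.normc0.
  by rewrite ltxx.
pose u x := (d k x - (db x)%:C) / (zeta`_k - beta%:C).
have dkO : isbigO (F := F) DC (d k).
  case: k {u nk zk0 kN} k2 => [|[|//]] _; apply: isbigO_complex;
    by apply: gauge_bigO => x; have [[? ? ?] [? ? ? ?]] := gauge_bounds x.
have uO : isbigO (F := F) DC u.
  apply: isbigO_Mbdr; last exact: isbigO1_cst.
  apply: isbigOB; first exact: dkO.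
  exact: (isbigO_real_complex _ _ db_bigO).
have u1 : islittleo (F := F) C1 u.
  apply: islittleo_Mbdr; last exact: isbigO1_cst.
  apply: islittleoB; first exact: d_o1.
  exact: (islittleo_real_complex R1 _ db_o1).
have usq : islittleo (F := F) DC (fun x => u x * (u x)^*%C).
  apply: islittleo_Mol; first exact: u1.
  apply: isbigO_le uO; apply: nearW => x.
  by rewrite !normcEC lecR; case: (u x) => r s /=; rewrite sqrrN.
apply: (@isuplittleo_le _ _ _ _ _ _ (fun x => 2^-1 * complex.Re (u x * (u x)^*%C))).
  apply: filterS (t_far _ kN) => x rt.
  have tu : t x k - (b x)%:C = (zeta`_k - beta%:C) * (1 + u x).
    rewrite mulrDr mulr1 /u mulrC divfK // /delta_zeta /delta_beta rmorphB /=; ring.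
  move: rt; rewrite tu ComplexField.Normc.normcM nk -[X in X < _]mulr1.
  rewrite ltr_pM2l // => u1lt.
  have : 1 ^+ 2 < normc (1 + u x) ^+ 2 by rewrite ltr_pXn2r // nnegrE ?normc_ge0.
  rewrite normc_sqr -/(u x); case: (u x) => r s /=.
  rewrite expr1n; lra.
apply: isuplittleo_Zl; first by rewrite invr_gt0.
by apply: islittleo_up; apply: islittleo_Re; exact: usq.
Qed.

(** The sum of [far_ineq] over all j, divided by 2 rho^2: the y_j^2 add up to [s2], and each x_j^2
    is o(D). *)
Lemma multiple_crit_up : isuplittleo F D (fun x =>
  (complex.Re (dS x) - N.+2%:R * db x) / rho - s2 x / (2 * rho ^+ 2)).
Proof.
pose X j x := complex.Re (d j x) - db x.
have XO j : (2 <= j < N.+4)%N -> islittleo (F := F) D (fun x => X j x ^+ 2).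
  move=> jN; apply: (@islittleo_eqfun _ _ _ _ _ _ (fun x => X j x * X j x)).
    by move=> x; rewrite expr2.
  apply: islittleo_Mol; last exact: xj_bigO.
  by apply: islittleoB; [exact: Re_o1 | exact: db_o1].
pose G x := (2 * rho ^+ 2)^-1 * \sum_(2 <= j < N.+4) X j x ^+ 2.
apply: (@isuplittleo_le _ _ _ _ _ _ G); last first.
  apply: islittleo_up; apply: islittleo_Zl.
  apply: islittleo_sum => j; rewrite mem_index_iota; exact: XO.
have all_far : \forall x \near F, forall i, i \in index_iota 2 N.+4 ->
    2 * rho * X i x < X i x ^+ 2 + complex.Im (d i x) ^+ 2.
  by apply: near_all => i; rewrite mem_index_iota; apply: far_ineq.
apply: filterS all_far => x far.
rewrite -sum_xj /G mulrC [X in _ - X]mulrC.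
have rho0 : rho != 0 by rewrite gt_eqF.
have -> : rho^-1 = (2 * rho ^+ 2)^-1 * (2 * rho) by field.
rewrite -mulrA -mulrBr ler_pM2l; last by rewrite invr_gt0 mulr_gt0 // exprn_gt0.
rewrite lerBlDr /im_sqr_sum -big_split mulr_sumr /= big_seq [leRHS]big_seq.
by apply: ler_sum => j jN; rewrite ltW // far.
Qed.

(** * Expansion of the perturbed polynomial and of its roots near the circle *)

Let U0 : {poly C} := 'X - (zeta`_0)%:P.
Let U1 : {poly C} := 'X - (zeta`_1)%:P.
Let Y : {poly C} := 'X - (a%:C)%:P.

Lemma critical_polyE : p = U0 * (U1 * Y ^+ N.+2).
Proof.
rewrite /p (big_nth 0) zeta_size big_ltn // big_ltn //; congr (_ * (_ * _)).
rewrite big_nat_cond (eq_bigr (fun=> Y)).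
  by rewrite -big_nat_cond prodr_const_nat subn2.
by move=> j; rewrite andbT => /zeta_a ->.
Qed.

Definition perturbed_poly (x : T) : {poly C} := \prod_(0 <= j < N.+4) ('X - (t x j)%:P).
Local Notation q := perturbed_poly.

Lemma perturbed_polyE x : q x = (U0 - (d 0 x)%:P) * ((U1 - (d 1 x)%:P) *
  \prod_(2 <= j < N.+4) (Y - (d j x)%:P)).
Proof.
have XE j : 'X - (t x j)%:P = ('X - (zeta`_j)%:P) - (d j x)%:P.
  by rewrite /delta_zeta polyCB; ring.
rewrite /q big_ltn // big_ltn // !XE; congr (_ * (_ * _)).
by apply: eq_big_nat => j /zeta_a jE; rewrite XE jE.
Qed.

(** The part of [q x - p] that is not o(D): the terms linear in the increments, and the second
    symmetric function of the increments at [a], of which only s2 / 2 survives. *)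
Definition poly_variation (x : T) : {poly C} :=
  - (d 0 x *: (U1 * Y ^+ N.+2)) - d 1 x *: (U0 * Y ^+ N.+2)
  - dS x *: (U0 * U1 * Y ^+ N.+1) + (s2 x / 2)%:C *: (U0 * U1 * Y ^+ N).
Local Notation L := poly_variation.

Lemma dS_bigO : isbigO (F := F) DC dS.
Proof. by apply: isbigO_complex; [exact: ReS_bigO | exact: ImS_bigO]. Qed.

Lemma dS_o1 : islittleo (F := F) C1 dS.
Proof. by apply: islittleo_sum => j _; exact: d_o1. Qed.

Lemma d0_bigO : isbigO (F := F) DC (d 0).
Proof.
by apply: isbigO_complex; apply: gauge_bigO => x; have [[]] := gauge_bounds x.
Qed.

Lemma d1_bigO : isbigO (F := F) DC (d 1).
Proof.
by apply: isbigO_complex; apply: gauge_bigO => x; have [_ []] := gauge_bounds x.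
Qed.

Lemma s2C_bigO : isbigO (F := F) DC (fun x => (s2 x / 2)%:C).
Proof.
apply: isbigO_real_complex; apply: isbigO_Mbdr; last exact: isbigO1_cst.
exact: s2_bigO.
Qed.

Definition second_esym (x : T) : C :=
  (dS x ^+ 2 - \sum_(2 <= j < N.+4) d j x ^+ 2) / 2.
Local Notation e2 := second_esym.

(** With d_j = u + i v, one has d_j^2 + v^2 = u (u + 2 i v), where u is O(D) and the other factor is
    o(1); the square of [dS] is o(D) for the same reason. *)
Lemma e2_expansion : islittleo (F := F) DC (fun x => e2 x - (s2 x / 2)%:C).
Proof.
pose G j x := (complex.Re (d j x))%:C *
  ((complex.Re (d j x))%:C + 2 * 'i%C * (complex.Im (d j x))%:C).
apply: (@islittleo_eqfun _ _ _ _ _ _ (fun x =>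
  2^-1 * (dS x * dS x - \sum_(2 <= j < N.+4) G j x))).
  move=> x; have -> : (s2 x / 2)%:C = 2^-1 * (s2 x)%:C.
    by rewrite rmorphM fmorphV rmorph_nat mulrC.
  rewrite /e2 [X in X - _]mulrC -mulrBr; congr (_ * _).
  rewrite expr2 -addrA; congr (_ + _).
  rewrite /im_sqr_sum rmorph_sum -opprD -big_split /=; congr (- _).
  apply: eq_bigr => j _; rewrite /G {1}[d j x]complexE.
  set u := complex.Re _; set v := complex.Im _; rewrite rmorphXn /=.
  have i2 : 'i%C * 'i%C = -1 :> C by rewrite -expr2 sqr_i.
  set uc := u%:C; set vc := v%:C.
  have -> : (uc + 'i%C * vc) ^+ 2 + vc ^+ 2 =
    uc ^+ 2 + 2 * 'i%C * uc * vc + ('i%C * 'i%C + 1) * vc ^+ 2 by ring.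
  by rewrite i2; ring.
apply: islittleo_Zl; apply: islittleoB.
  by apply: islittleo_Mol; [exact: dS_o1 | exact: dS_bigO].
apply: islittleo_sum => j _; apply: islittleo_Mor.
  by apply: isbigO_real_complex; exact: Re_bigO.
apply: islittleoD.
  exact: (islittleo_real_complex R1 _ (Re_o1 j)).
apply: islittleo_Zl; exact: (islittleo_real_complex R1 _ (Im_o1 j)).
Qed.

Lemma e2_bigO : isbigO (F := F) DC e2.
Proof.
apply: (@isbigO_eqfun _ _ _ _ _ _ (fun x => (e2 x - (s2 x / 2)%:C) + (s2 x / 2)%:C)).
  by move=> x; rewrite subrK.
apply: isbigOD; last exact: s2C_bigO.
by apply: islittleo_bigO; exact: e2_expansion.
Qed.

Lemma perturbed_poly_expansion : plittleo (F := F) DC (fun x => q x - p - L x).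
Proof.
pose Rm x := \prod_(2 <= j < N.+4) (Y - (d j x)%:P) -
  (Y ^+ N.+2 - dS x *: Y ^+ N.+1 + e2 x *: Y ^+ N).
have RmO : plittleo (F := F) DC Rm.
  exact: (@prod_second_order _ _ F _ Y DC d 2 N d_o1 dd_bigO).
(* Multiplying out leaves the remainder of [prod_second_order], the error on [e2], and terms with an
   o(1) coefficient times an O(D) one. *)
apply: (@plittleo_eqfun _ _ _ _ _ _ (fun x =>
  ((U0 - (d 0 x)%:P) * (U1 - (d 1 x)%:P)) * Rm x
  + (e2 x - (s2 x / 2)%:C) *: (U0 * U1 * Y ^+ N)
  + (d 0 x * d 1 x) *: Y ^+ N.+2
  + (d 0 x * dS x) *: (U1 * Y ^+ N.+1)
  + (d 1 x * dS x) *: (U0 * Y ^+ N.+1)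
  - (d 0 x * d 1 x * dS x) *: Y ^+ N.+1
  - (d 0 x * e2 x) *: (U1 * Y ^+ N)
  - (d 1 x * e2 x) *: (U0 * Y ^+ N)
  + (d 0 x * d 1 x * e2 x) *: Y ^+ N)).
  move=> x; rewrite critical_polyE perturbed_polyE /L /Rm.
  move: (\prod_(2 <= j < N.+4) _) (s2 x / 2)%:C (d 0 x) (d 1 x) (dS x) (e2 x).
  move=> Pi h d0 d1 S e.
  rewrite -!mul_polyC !polyCM polyCB !exprS; move: (Y ^+ N) => YN.
  by clearbody U0 U1 Y; ring.
have Ub (V : {poly C}) j : pbigO (F := F) C1 (fun x => V - (d j x)%:P).
  apply: pbigOB; first exact: pbigO1_cst.
  apply: (@pbigO_eqfun _ _ _ _ _ _ (fun x => d j x *: 1)).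
    by move=> x; rewrite alg_polyC.
  by apply: pbigOZ; apply: islittleo_bigO; exact: d_o1.
have o1 u v : islittleo (F := F) C1 u -> isbigO (F := F) DC v ->
    forall V, plittleo (F := F) DC (fun x => (u x * v x) *: V).
  by move=> uo vO V; apply: plittleoZ; apply: islittleo_Mol; [exact: uo|exact: vO].
have d01o1 : islittleo (F := F) C1 (fun x => d 0 x * d 1 x).
  by apply: islittleo_Mol; [exact: d_o1 | apply: islittleo_bigO; exact: d_o1].
apply: plittleoD; last exact: o1 d01o1 e2_bigO _.
apply: plittleoB; last exact: o1 (d_o1 1) e2_bigO _.
apply: plittleoB; last exact: o1 (d_o1 0) e2_bigO _.
apply: plittleoB; last exact: o1 d01o1 dS_bigO _.
apply: plittleoD; last exact: o1 (d_o1 1) dS_bigO _.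
apply: plittleoD; last exact: o1 (d_o1 0) dS_bigO _.
apply: plittleoD; last exact: o1 (d_o1 0) d1_bigO _.
apply: plittleoD; last by apply: plittleoZ; exact: e2_expansion.
apply: plittleo_Mbdl; last exact: RmO.
move=> i; apply: (@isbigO_eqfun _ _ _ _ _ _ (fun x =>
  \sum_(j < i.+1) (U0 - (d 0 x)%:P)`_j * (U1 - (d 1 x)%:P)`_(i - j))).
  by move=> x; rewrite coefM.
by apply: isbigO_sum => j _; apply: isbigO_Mbdr; apply: Ub.
Qed.
Lemma critical_polyE0 : ('X - (zeta`_0)%:P) * (U1 * Y ^+ N.+2) = p.
Proof. by rewrite critical_polyE. Qed.

Lemma critical_polyE1 : ('X - (zeta`_1)%:P) * (U0 * Y ^+ N.+2) = p.
Proof. by rewrite critical_polyE -/U1 mulrCA. Qed.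

Lemma critical_polyE2 : ('X - (zeta`_2)%:P) * (U0 * U1 * Y ^+ N.+1) = p.
Proof. by rewrite critical_polyE zeta_a // -/Y [Y ^+ N.+2]exprS mulrCA -!mulrA. Qed.

Lemma critical_polyE22 : (U0 * U1 * Y ^+ N) * Y ^+ 2 = p.
Proof. by rewrite critical_polyE -mulrA -exprD addn2 -[LHS]mulrA. Qed.

Lemma size_poly_variation : exists B, (size p <= B)%N /\
  (forall x, (size (q x) <= B)%N /\ (size (L x) <= B)%N).
Proof.
pose s0 := size (U1 * Y ^+ N.+2); pose s1 := size (U0 * Y ^+ N.+2).
pose s2' := size (U0 * U1 * Y ^+ N.+1); pose s3 := size (U0 * U1 * Y ^+ N).
pose B := maxn N.+4.+1 (maxn (maxn s0 s1) (maxn s2' s3)).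
have Bq : (N.+4.+1 <= B)%N by rewrite leq_maxl.
have BM : [/\ s0 <= B, s1 <= B, s2' <= B & s3 <= B]%N.
  by split; rewrite /B !leq_max leqnn ?orbT.
exists B; split; first by rewrite size_prod_XsubC zeta_size.
move=> x; split; first by rewrite size_prod_XsubC size_iota subn0.
have [b0 b1 b2 b3] := BM.
have sZ c (M : {poly C}) : (size M <= B)%N -> (size (c *: M) <= B)%N.
  exact: leq_trans (size_scale_leq _ _).
rewrite (leq_trans (size_polyD _ _)) // geq_max (sZ _ _ b3) andbT.
rewrite size_polyB_leq ?(sZ _ _ b2) //.
by rewrite size_polyB_leq ?(sZ _ _ b1) // size_polyN (sZ _ _ b0).
Qed.

Lemma circle_root_expansion i : (i < m)%N -> islittleo (F := F) DC (fun x =>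
  w x i - z`_i - (p.[beta%:C] * (db x)%:C - pint (L x) beta%:C z`_i) / p.[z`_i]).
Proof.
move=> im; have [B [pB qLB]] := size_poly_variation.
have LO : pbigO (F := F) DC L.
  apply: pbigOD; last by apply: pbigOZ; exact: s2C_bigO.
  apply: pbigOB; last by apply: pbigOZ; exact: dS_bigO.
  apply: pbigOB; last by apply: pbigOZ; exact: d1_bigO.
  by apply: pbigON; apply: pbigOZ; exact: d0_bigO.
apply: (@islittleo_eqfun _ _ _ _ _ _ (fun x => w x i - z`_i -
  (p.[beta%:C] * ((b x)%:C - beta%:C) - pint (L x) beta%:C z`_i) / p.[z`_i])).
  by move=> x; rewrite /delta_beta rmorphB.
apply: (@root_expansion _ _ F _ B DC p q L (fun x => (b x)%:C) (w^~ i)).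
- exact: pB.
- by move=> x; have [] := qLB x.
- by move=> x; have [] := qLB x.
- apply: (@islittleo_eqfun _ _ _ _ _ _ (fun x => (db x)%:C)).
    by move=> x; rewrite /delta_beta rmorphB.
  exact: (islittleo_real_complex R1 _ db_o1).
- exact: w_lim.
- apply: (@isbigO_eqfun _ _ _ _ _ _ (fun x => (db x)%:C)).
    by move=> x; rewrite /delta_beta rmorphB.
  by apply: isbigO_real_complex; exact: db_bigO.
- exact: perturbed_poly_expansion.
- exact: LO.
- exact: z_simple.
- exact: z_root.
- exact: w_root.
Qed.

(** [p] contains the factor [Y] to the power [N.+2], at least 2, so the double pole at [a]
    cancels. *)
Lemma cint_double_pole i : (i < m)%N ->
  cint (fun y => P^`().[y] / (y - a%:C) ^+ 2) beta%:C z`_i =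
  lambda * pint (U0 * U1 * Y ^+ N) beta%:C z`_i.
Proof.
move=> im; rewrite -pintZ; apply: (@cint_horner _ _ _ a%:C) => y ya.
rewrite P_deriv -critical_polyE22 !hornerZ [in LHS]hornerM horner_exp hornerXsubC.
have ya0 : y - a%:C != 0 by rewrite subr_eq0.
by rewrite mulrA mulfK // expf_neq0.
Qed.

(** The terms of [L] linear in the increments reproduce E through the partial derivatives of the
    root, and its term in [s2] reproduces F; [lambda] cancels. *)
Lemma EF_circle i x : (i < m)%N ->
  E n beta a z zeta (db x) (d 0 x) (d 1 x) (dS x) i.+3 + Defs.F P beta a z (s2 x) i.+3 =
  complex.Re ((z`_i)^-1 *
    ((p.[beta%:C] * (db x)%:C - pint (L x) beta%:C z`_i) / p.[z`_i])).
Proof.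
move=> im; have pz := z_simple _ im; have pb := z_root _ im.
have [jz0 jz1 jz2] : [/\ 0 < size zeta, 1 < size zeta & 2 < size zeta]%N.
  by rewrite zeta_size.
rewrite /E /Defs.F cint_double_pole // P_deriv hornerZ.
rewrite (dz_dbetaE _ _ _ _ pb pz).
rewrite (dz_dzetaE _ _ _ _ 0 _ jz0 critical_polyE0 pb pz).
rewrite (dz_dzetaE _ _ _ _ 1 _ jz1 critical_polyE1 pb pz).
rewrite (dz_dzetaE _ _ _ _ 2 _ jz2 critical_polyE2 pb pz).
rewrite -!cReMr -!cReD -cReN -cReMr -cReD; congr (complex.Re _).
rewrite /L !(pintD, pintN, pintZ).
have zi0 : z`_i != 0 by rewrite -normr_gt0 z_norm.
set i0 := pint _ _ _; set i1 := pint _ _ _; set i2 := pint _ _ _.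
set i3 := pint _ _ _.
have -> : (s2 x / 2)%:C = (s2 x)%:C / 2 by rewrite rmorphM fmorphV rmorph_nat.
set sc := (s2 x)%:C; set dbc := (db x)%:C.
move: (dS x) (d 0 x) (d 1 x) => S d0 d1.
move: lambda_neq0 zi0 pz; set zi := z`_i; set pz := p.[_]; set pbe := p.[_].
clearbody i0 i1 i2 i3 sc dbc zi pz pbe => l0 zi0 pz0.
by field; rewrite l0 zi0 pz0.
Qed.

(** As |w_i| <= 1 = |z_i|, the real part of w_i / z_i is at most 1; by the expansion of w_i this
    quotient is 1 plus the variation in [EF_circle] plus o(D). *)
Lemma circle_up i : (i < m)%N -> isuplittleo F D (fun x =>
  E n beta a z zeta (db x) (d 0 x) (d 1 x) (dS x) i.+3 + Defs.F P beta a z (s2 x) i.+3).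
Proof.
move=> im; have zi0 : z`_i != 0 by rewrite -normr_gt0 z_norm.
pose W x := w x i - z`_i -
  (p.[beta%:C] * (db x)%:C - pint (L x) beta%:C z`_i) / p.[z`_i].
apply: (@isuplittleo_le _ _ _ _ _ _ (fun x => complex.Re (- (z`_i)^-1 * W x))).
  apply: filterS (w_disk _ im) => x wx; rewrite EF_circle //.
  rewrite -subr_ge0 -cReB.
  have -> : - (z`_i)^-1 * W x - (z`_i)^-1 *
     ((p.[beta%:C] * (db x)%:C - pint (L x) beta%:C z`_i) / p.[z`_i]) =
     1 - (z`_i)^-1 * w x i.
    rewrite /W -[1](mulVf zi0); set u := _ / _; clearbody u; ring.
  rewrite cReB subr_ge0 /=.
  apply: le_trans (ler_norm _) _; apply: le_trans (norm_Re_le _) _.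
  rewrite -lecR -normcEC normrM normfV z_norm // invr1 mul1r.
  exact: wx.
apply: islittleo_up; apply: islittleo_Re; apply: islittleo_Zl.
exact: circle_root_expansion.
Qed.
Lemma EF_up k : (k < m + 3)%N -> isuplittleo F D (fun x =>
  E n beta a z zeta (db x) (d 0 x) (d 1 x) (dS x) k + Defs.F P beta a z (s2 x) k).
Proof.
case: k => [|[|[|i]]] km.
- apply: (isuplittleo_le _ _ _ _ (near_crit_up 0 isT)).
  by apply: nearW => x; rewrite /= addr0.
- apply: (isuplittleo_le _ _ _ _ (near_crit_up 1 isT)).
  by apply: nearW => x; rewrite /= addr0.
- apply: (isuplittleo_le _ _ _ _ multiple_crit_up).
  by apply: nearW => x; rewrite /=.
- by apply: circle_up; rewrite addn3 !ltnS in km.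
Qed.

(** * Consequences of properties G and H *)

Lemma s2_o : islittleo (F := F) D s2.
Proof.
have [c c0 cE] := hG.
have E2 x : \sum_(k < m + 3) c k * (E n beta a z zeta (db x) (d 0 x) (d 1 x) (dS x) k
    + Defs.F P beta a z (s2 x) k) = s2 x.
  have [e1 e2] := cE (db x) (fun j => d j x).
  by under eq_bigr => k _ do rewrite mulrDr; rewrite big_split /= e1 e2 add0r.
apply: isuplittleo_littleo; last first.
  apply: (@isuplittleo_le _ _ _ _ _ _ (fun=> 0)).
    by apply: nearW => x; rewrite oppr_le0 s2_ge0.
  by apply: islittleo_up; exact: islittleo0.
apply: (@isuplittleo_le _ _ _ _ _ _ (fun x => \sum_(k < m + 3) c k *
  (E n beta a z zeta (db x) (d 0 x) (d 1 x) (dS x) k + Defs.F P beta a z (s2 x) k))).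
  by apply: nearW => x; rewrite E2.
apply: isuplittleo_sum => k _.
by apply: isuplittleo_Zl; [exact: c0 | exact: EF_up].
Qed.

Lemma F_o k : islittleo (F := F) D (fun x => Defs.F P beta a z (s2 x) k).
Proof.
have FE x : Defs.F P beta a z (s2 x) k = Defs.F P beta a z 1 k * s2 x.
  by case: k => [|[|[|i]]] /=; rewrite ?mul0r // ?mulr1 // mulNr mulrC mul1r.
apply: islittleo_eqfun FE _; apply: islittleo_Zl; exact: s2_o.
Qed.

Lemma E_up k : (k < m + 3)%N -> isuplittleo F D (fun x =>
  E n beta a z zeta (db x) (d 0 x) (d 1 x) (dS x) k).
Proof.
move=> km.
apply: (@isuplittleo_le _ _ _ _ _ _ (fun x =>
  (E n beta a z zeta (db x) (d 0 x) (d 1 x) (dS x) k + Defs.F P beta a z (s2 x) k)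
  + - Defs.F P beta a z (s2 x) k)).
  by apply: nearW => x; rewrite addrK.
apply: isuplittleoD; first exact: EF_up.
by apply: islittleo_up; apply: islittleoN; exact: F_o.
Qed.

(** By the first identity of G, - E_k is a combination of the other forms with positive
    coefficients, so their upper bounds give the missing lower bound. *)
Lemma E_o k : (k < m + 3)%N -> islittleo (F := F) D (fun x =>
  E n beta a z zeta (db x) (d 0 x) (d 1 x) (dS x) k).
Proof.
move=> km; apply: isuplittleo_littleo; first exact: E_up.
have [c c0 cE] := hG; pose ok := Ordinal km.
have ck : 0 < (c k)^-1 by rewrite invr_gt0 c0.
apply: (@isuplittleo_le _ _ _ _ _ _ (fun x => (c k)^-1 * \sum_(l < m + 3 | l != ok)
  c l * E n beta a z zeta (db x) (d 0 x) (d 1 x) (dS x) l)); last first.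
  apply: isuplittleo_Zl; first exact: ck.
  apply: isuplittleo_sum => l _.
  by apply: isuplittleo_Zl; [exact: c0 | exact: E_up].
apply: nearW => x; have [e1 _] := cE (db x) (fun j => d j x).
move: e1; rewrite (bigD1 ok) //= => /eqP; rewrite addrC addr_eq0 => /eqP ->.
by rewrite mulrN mulrA mulVf ?mul1r // gt_eqF // c0.
Qed.

Definition variables (x : T) : 'rV[R]_7 := \row_(l < 7)
  [:: db x; complex.Re (d 0 x); complex.Im (d 0 x); complex.Re (d 1 x);
      complex.Im (d 1 x); complex.Re (dS x); complex.Im (dS x)]`_l.

Lemma E7_variables x k : E7 n beta a z zeta (variables x) k =
  E n beta a z zeta (db x) (d 0 x) (d 1 x) (dS x) k.
Proof.
rewrite /E7 !mxE /=.
by case: (d 0 x) (d 1 x) (dS x) => [? ?] [? ?] [? ?].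
Qed.

Lemma E7_linear (v : 'rV[R]_7) k : E7 n beta a z zeta v k =
  \sum_(l < 7) v 0 l * E7 n beta a z zeta (delta_mx 0 l) k.
Proof.
do 7 rewrite big_ord_recl; rewrite big_ord0 /E7 !mxE /=.
have -> : (lift ord0 ord0 : 'I_7) = 1 by apply: val_inj.
have -> : (lift ord0 (lift ord0 ord0) : 'I_7) = 2 by apply: val_inj.
have -> : (lift ord0 (lift ord0 (lift ord0 ord0)) : 'I_7) = 3 by apply: val_inj.
have -> : (lift ord0 (lift ord0 (lift ord0 (lift ord0 ord0))) : 'I_7) = 4.
  by apply: val_inj.
have -> : (lift ord0 (lift ord0 (lift ord0 (lift ord0 (lift ord0 ord0)))) : 'I_7) = 5.
  by apply: val_inj.
have -> : (lift ord0 (lift ord0 (lift ord0 (lift ord0 (lift ord0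
  (lift ord0 ord0))))) : 'I_7) = 6.
  by apply: val_inj.
have -> : (ord0 : 'I_7) = 0 by [].
move: (v 0 0) (v 0 1) (v 0 2) (v 0 3) (v 0 4) (v 0 5) (v 0 6) => v0 v1 v2 v3 v4 v5 v6.
case: k => [|[|[|i]]]; rewrite /E /=.
- case: (_^-1) => u1 u2 /=; ring.
- case: (_^-1) => u1 u2 /=; ring.
- ring.
move: (dz_dbeta beta%:C zeta z`_i) (dz_dzeta beta%:C zeta z`_i) (z`_i)^-1.
move=> db0 g zi; move: (zi * db0) (g 0%N) (g 1%N) (g 2%N) => {db0 g} u0 g0 g1 g2.
move: (zi * g0) (zi * g1) (zi * g2) => [? ?] [? ?] [? ?] /=; ring.
Qed.

(** By full column rank the coefficient matrix has a left inverse [B], which expresses every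
    variable as a fixed linear combination of the E_k. *)
Lemma variables_o l : islittleo (F := F) D (fun x => variables x 0 l).
Proof.
have : row_full (Defs.coefE n beta a z zeta m) by rewrite /row_full hH.
move=> /row_fullP [B BE].
apply: (@islittleo_eqfun _ _ _ _ _ _ (fun x => \sum_(k <- index_enum 'I_(m + 3))
   B l k * E n beta a z zeta (db x) (d 0 x) (d 1 x) (dS x) k)).
  move=> x; have := mulmx1 (variables x); rewrite -[1%:M]trmx1 -BE trmx_mul mulmxA.
  move=> /(congr1 (fun M : 'rV__ => M 0 l)) <-; rewrite mxE.
  apply: eq_bigr => k _; rewrite mulrC [_^T _ _]mxE; congr (_ * _).
  rewrite -E7_variables E7_linear mxE; apply: eq_bigr => j _.
  by rewrite !mxE.
apply: islittleo_sum => k _; apply: islittleo_Zl; exact: E_o.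
Qed.

Lemma gauge_o : islittleo (F := F) D D.
Proof.
have vo (l : nat) (f : T -> R) : (l < 7)%N ->
    (forall x, f x = [:: db x; complex.Re (d 0 x); complex.Im (d 0 x);
      complex.Re (d 1 x); complex.Im (d 1 x); complex.Re (dS x);
      complex.Im (dS x)]`_l) -> islittleo (F := F) D (fun x => `|f x|).
  move=> l7 fE; apply: islittleo_le (variables_o (Ordinal l7)).
  by apply: nearW => x; rewrite normr_id mxE fE.
apply: islittleoD; last exact: s2_o.
apply: islittleoD; last exact: (vo 6).
apply: islittleoD; last exact: (vo 5).
apply: islittleoD; last exact: (vo 4).
apply: islittleoD; last exact: (vo 3).
apply: islittleoD; last exact: (vo 2).
apply: islittleoD; last exact: (vo 1).
exact: (vo 0).
Qed.

Lemma no_improving_perturbation : False.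
Proof.
have h2 : 0 < (2^-1 : R) by rewrite invr_gt0.
have : \forall x \near F, False.
  apply: filterS2 (gauge_o _ h2) (t_far 0 isT) => x.
  rewrite (ger0_norm (gauge_ge0 x)) => Dle far.
  have D0 : D x = 0 by have := gauge_ge0 x; move: Dle; lra.
  have [[]] := gauge_bounds x; rewrite D0 !normr_le0 => /eqP db0 /eqP r0 /eqP i0 _.
  have d0 : d 0 x = 0 by move: r0 i0; case: (d 0 x) => u v /= -> ->.
  move: far; have -> : t x 0 = zeta`_0 by apply/eqP; rewrite -subr_eq0; apply/eqP.
  have -> : b x = beta by apply/eqP; rewrite -subr_eq0; apply/eqP.
  by rewrite zeta_dist // ltxx.
by move/filter_ex => [].
Qed.

End Perturbation.

(** * Extraction of a perturbation from a sequence of polynomials *)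

Section Distances.
Context {R : realType}.
Local Notation C := R[i].
Implicit Types (s : seq C) (z w : C) (P Q : {poly C}).

Lemma cdistC z w : cdist z w = cdist w z.
Proof. by rewrite /cdist; apply: complexI; rewrite -!normcEC distrC. Qed.

Lemma cdist_triangle u z w : cdist z w <= cdist z u + cdist u w.
Proof.
rewrite /cdist; have -> : z - w = (z - u) + (u - w) by rewrite addrA subrK.
by rewrite -lecR rmorphD /= -!normcEC ler_normD.
Qed.

Lemma mindist_ge s z c : s != [::] -> (forall w, w \in s -> c <= cdist z w) ->
  c <= mindist s z.
Proof.
move=> s0 sc; rewrite /mindist big_seq; apply: le_bigmin => //.
by apply: sc; apply: mem_nth; rewrite lt0n size_eq0.
Qed.

Lemma mindist_le s z w : w \in s -> mindist s z <= cdist z w.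
Proof. by move=> ws; apply: ge_bigmin_seq. Qed.

Lemma mindist_lt s z c : s != [::] -> mindist s z < c ->
  exists2 w, w \in s & cdist z w < c.
Proof.
move=> s0 mc; apply: contrapT => H; move: mc; apply/negP; rewrite -leNgt.
apply: mindist_ge => // w ws; rewrite leNgt; apply/negP => wc.
by apply: H; exists w.
Qed.

Lemma mem_croots P z : P != 0 -> (z \in croots P) = root P z.
Proof.
move=> P0; rewrite /croots; case: closed_field_poly_normal => s /= sE.
by rewrite sE rootZ ?lead_coef_eq0 // root_prod_XsubC.
Qed.

Lemma crootsE P : lists_roots P (croots P).
Proof. by rewrite /croots; case: closed_field_poly_normal. Qed.

Lemma size_croots P : P != 0 -> size P = (size (croots P)).+1.
Proof.
move=> P0; rewrite {1}(crootsE P) size_scale ?lead_coef_eq0 //.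
by rewrite size_prod_XsubC.
Qed.

Lemma dmax_gt P c : 0 <= c -> c < dmax P ->
  exists2 z, z \in croots P & c < mindist (croots P^`()) z.
Proof.
move=> c0 cP; apply: contrapT => H; move: cP; apply/negP; rewrite -leNgt.
rewrite /dmax big_seq; apply: bigmax_le => // z zP.
by rewrite leNgt; apply/negP => cz; apply: H; exists z.
Qed.

Lemma dmax_ge P z : z \in croots P -> mindist (croots P^`()) z <= dmax P.
Proof. by move=> zP; apply: Order.TotalTheory.le_bigmax_seq. Qed.

Lemma lists_roots_perm P s s' : P != 0 ->
  lists_roots P s -> lists_roots P s' -> perm_eq s s'.
Proof.
move=> P0 Ps Ps'; apply: prod_XsubC_eq.
have l0 : lead_coef P != 0 by rewrite lead_coef_eq0.
by apply: (scalerI l0); rewrite -Ps -Ps'.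
Qed.

Lemma deriv_prod_XsubC k (W : seq C) : size W = k.+1 ->
  exists2 S : seq C, size S = k &
    (\prod_(x <- W) ('X - x%:P))^`() = k.+1%:R *: \prod_(x <- S) ('X - x%:P).
Proof.
move=> sW; set Q := \prod_(x <- W) _.
have sQ : size Q = k.+2 by rewrite size_prod_XsubC sW.
have lQ : Q`_k.+1 = 1.
  by have /monicP := monic_prod_XsubC W xpredT id; rewrite lead_coefE -/Q sQ.
have dQ : Q^`()`_k = k.+1%:R by rewrite coef_deriv lQ.
have k0 : k.+1%:R != 0 :> C by rewrite pnatr_eq0.
have sdQ : size Q^`() = k.+1.
  apply/eqP; rewrite eqn_leq; apply/andP; split.
    by rewrite -ltnS -sQ lt_size_deriv // -size_poly_eq0 sQ.
  rewrite ltnNge; apply/negP => /leq_sizeP /(_ k (leqnn _)) /eqP.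
  by rewrite dQ (negbTE k0).
have Q'0 : Q^`() != 0 by rewrite -size_poly_eq0 sdQ.
exists (croots Q^`()); first by apply: eq_add_S; rewrite -size_croots.
by rewrite {1}(crootsE Q^`()) lead_coefE sdQ dQ.
Qed.

Lemma lists_roots_deriv k P (W S : seq C) : size P = k.+2 ->
  lists_roots P W -> lists_roots P^`() S ->
  [/\ size S = k,
    (\prod_(x <- W) ('X - x%:P))^`() = k.+1%:R *: \prod_(x <- S) ('X - x%:P) &
    P^`() = (k.+1%:R * lead_coef P) *: \prod_(x <- S) ('X - x%:P)].
Proof.
move=> sP PW PS; have P0 : P != 0 by rewrite -size_poly_eq0 sP.
have l0 : lead_coef P != 0 by rewrite lead_coef_eq0.
have sW : size W = k.+1.
  by apply/eqP; rewrite -eqSS -sP PW size_scale // size_prod_XsubC.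
have [S' sS' dW] := deriv_prod_XsubC _ _ sW.
have dP : P^`() = (k.+1%:R * lead_coef P) *: \prod_(x <- S') ('X - x%:P).
  by rewrite {1}PW derivZ dW scalerA mulrC.
have c0 : k.+1%:R * lead_coef P != 0 by rewrite mulf_neq0 // pnatr_eq0.
have lP : lead_coef P^`() = k.+1%:R * lead_coef P.
  by rewrite dP lead_coefZ (monicP (monic_prod_XsubC _ _ _)) mulr1.
have P'0 : P^`() != 0 by rewrite -lead_coef_eq0 lP.
have PS' : lists_roots P^`() S' by rewrite /lists_roots lP.
have pSS' := lists_roots_perm _ _ _ P'0 PS PS'.
have SS' : \prod_(x <- S) ('X - x%:P) = \prod_(x <- S') ('X - x%:P).
  exact: perm_big.
by rewrite dW dP SS' (perm_size pSS').
Qed.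

(** A neighborhood pairs the roots of Q with some listing of those of P, whereas [z] is fixed with
    the circle roots first; the permutation between the two listings is carried over to [ws]. *)
Lemma lists_roots_matching n (eps : R) P (zs ws : n.-tuple C) (z : seq C) :
  P != 0 -> lists_roots P zs -> lists_roots P z ->
  (forall i : 'I_n, cdist (tnth zs i) (tnth ws i) < eps) ->
  exists W : seq C, [/\ size W = n, perm_eq W ws &
    forall i, (i < n)%N -> cdist z`_i W`_i < eps].
Proof.
move=> P0 Pzs Pz H.
have /(perm_iotaP 0) [Is Isp zE] := lists_roots_perm _ _ _ P0 Pz Pzs.
have sIs : size Is = n by rewrite (perm_size Isp) size_iota size_tuple.
exists [seq ws`_i | i <- Is]; split.
- by rewrite size_map.
- have wsE : [seq ws`_i | i <- iota 0 n] = ws.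
    by rewrite -[in iota 0 n](size_tuple ws) map_nth_iota0 // take_size.
  by rewrite -[X in perm_eq _ X]wsE perm_map // -[in iota 0 n](size_tuple zs).
- move=> i iN; rewrite zE !(nth_map 0%N) ?sIs //.
  have : (Is`_i)%R \in iota 0 n.
    by rewrite -[in iota 0 n](size_tuple zs) -(perm_mem Isp) mem_nth ?sIs.
  rewrite mem_iota add0n => /= jn.
  by have := H (Ordinal jn); rewrite !(tnth_nth 0).
Qed.

Lemma simple_root_deriv P z : P != 0 -> root P z -> mup z P = 1%N ->
  P^`().[z] != 0.
Proof.
move=> P0 /factor_theorem [g Pg] mz; apply/negP => /eqP dz.
have : root g z.
  by rewrite rootE -dz Pg derivM derivXsubC !hornerE subrr mulr0 add0r.
move=> /factor_theorem [h gh].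
have : (2 <= mup z P)%N.
  by rewrite mup_geq // Pg gh -mulrA -expr2 dvdp_mull.
by rewrite mz.
Qed.

End Distances.

Section Competitors.
Context {R : realType}.
Local Notation C := R[i].

(* The data extracted from a polynomial Q with dmax Q > r: the list of its
   roots, that of its critical points, and a root at distance more than r
   from every critical point. *)
Definition competitor (k : nat) (z : seq C) (r eps : R)
    (x : seq C * seq C * C) : Prop :=
  let: (W, V, b) := x in
  [/\ size W = k.+1, size V = k &
      (\prod_(u <- W) ('X - u%:P))^`() = k.+1%:R *: \prod_(u <- V) ('X - u%:P)] /\
  [/\ forall i, (i < k.+1)%N -> `|W`_i| <= 1,
      forall i, (i < k.+1)%N -> cdist z`_i W`_i < eps,
      b \in W & forall s, s \in V -> r < cdist s b].

Lemma in_nbhd_competitor k (P Q : {poly C}) (z : seq C) (r eps : R) :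
  size P = k.+2 -> lists_roots P z -> 0 <= r ->
  in_nbhd k.+1 eps P Q -> r < dmax Q -> exists x, competitor k z r eps x.
Proof.
move=> sP Pz r0 [[sQ Qdisk] [zs [ws [Pzs Qws zw]]]] rQ.
have P0 : P != 0 by rewrite -size_poly_eq0 sP.
have Q0 : Q != 0 by rewrite -size_poly_eq0 sQ.
have [W [sW Wws zW]] := lists_roots_matching _ _ _ _ _ _ P0 Pzs Pz zw.
have QW : lists_roots Q W by rewrite /lists_roots (perm_big _ Wws).
have [b bQ rb] := dmax_gt _ _ r0 rQ.
have [sV dW _] := lists_roots_deriv _ _ _ _ sQ QW (crootsE Q^`()).
have rootW u : u \in W -> root Q u.
  by move=> uW; rewrite QW rootZ ?lead_coef_eq0 // root_prod_XsubC.
exists (W, croots Q^`(), b); split; split => //.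
- by move=> i ik; apply: Qdisk; apply: rootW; apply: mem_nth; rewrite sW.
- move: bQ; rewrite mem_croots // {1}QW rootZ ?lead_coef_eq0 //.
  by rewrite root_prod_XsubC.
- move=> s sS; rewrite cdistC (lt_le_trans rb) //; exact: mindist_le.
Qed.

Lemma tendsto_natSinv (l : C) (u : nat -> C) :
  (forall k, cdist l (u k) < k.+1%:R^-1) -> tendsto (F := \oo) u l.
Proof.
move=> H; apply/tendstoP => e /posc_Re[e0 ->].
apply: filterS (near_infty_natSinv_lt (PosNum e0)) => k ke.
rewrite distrC normcEC lecR; apply: ltW; exact: lt_trans (H k) ke.
Qed.

Lemma competitor_nth_tendsto (k : nat) (z : seq C) (r : R)
    (X : nat -> seq C * seq C * C) i : (i < k.+1)%N ->
  (forall j, competitor k z r j.+1%:R^-1 (X j)) ->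
  tendsto (F := \oo) (fun j => (X j).1.1`_i) z`_i.
Proof.
move=> ik Xc; apply: tendsto_natSinv => j.
by have := Xc j; case: (X j) => [[W V] b] [_ [_ + _ _]] /=; apply.
Qed.

Lemma ptendsto_deriv {T : Type} {F : set_system T} {FF : Filter F}
    (u : T -> {poly C}) (p : {poly C}) :
  ptendsto (F := F) u p -> ptendsto (F := F) (fun t => (u t)^`()) p^`().
Proof.
move=> up i; rewrite coef_deriv -mulr_natl.
apply: (@tendsto_eq _ _ _ _ _ (fun t => i.+1%:R * (u t)`_i.+1)).
  by apply: nearW => t; rewrite coef_deriv mulr_natl.
by apply: tendstoM; [exact: tendsto_cst | exact: up].
Qed.

(** Convergence of the roots gives that of the coefficients, hence of those of the derivative, and
    [roots_tendsto] then orders the critical points suitably. *)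
Lemma competitor_critical_points (k : nat) (z zeta : seq C) (r : R)
    (X : nat -> seq C * seq C * C) :
  size z = k.+1 -> size zeta = k ->
  (\prod_(u <- z) ('X - u%:P))^`() = k.+1%:R *: \prod_(u <- zeta) ('X - u%:P) ->
  (forall j, competitor k z r j.+1%:R^-1 (X j)) ->
  exists v : nat -> seq C, (forall j, perm_eq (X j).1.2 (v j)) /\
    (forall i, tendsto (F := \oo) (fun j => (v j)`_i) zeta`_i).
Proof.
move=> sz szeta dz Xc.
have k0 : k.+1%:R != 0 :> C by rewrite pnatr_eq0.
apply: roots_tendsto => [j|].
  by have := Xc j; case: (X j) => [[W V] b] [[_ sS _] _] /=; rewrite sS szeta.
have WE j : \prod_(u <- (X j).1.1) ('X - u%:P) =
    \prod_(0 <= i < k.+1) ('X - ((X j).1.1`_i)%:P).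
  have := Xc j; case: (X j) => [[W V] b] [[sW _ _] _] /=.
  by rewrite (big_nth 0) sW.
have Wlim : ptendsto (F := \oo) (fun j => \prod_(0 <= i < k.+1) ('X - ((X j).1.1`_i)%:P))
    (\prod_(0 <= i < k.+1) ('X - (z`_i)%:P)).
  (* Out of range the entries are replaced by their limits, so that convergence holds at every
     index. *)
  pose W' i j := if (i < k.+1)%N then (X j).1.1`_i else z`_i.
  have W'E j : \prod_(0 <= i < k.+1) ('X - ((X j).1.1`_i)%:P) =
      \prod_(0 <= i < k.+1) ('X - (W' i j)%:P).
    by apply: eq_big_nat => i /andP[_ ik]; rewrite /W' ik.
  have H : ptendsto (F := \oo) (fun j => \prod_(0 <= i < k.+1) ('X - (W' i j)%:P))
      (\prod_(0 <= i < k.+1) ('X - (z`_i)%:P)).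
    apply: ptendsto_prod => i _; apply: ptendsto_XsubC; rewrite /W'.
    case: ltnP => ik; last exact: tendsto_cst.
    exact: competitor_nth_tendsto Xc.
  by move=> i; apply: tendsto_eq (H i); apply: nearW => j; rewrite W'E.
have dz' : (\prod_(0 <= i < k.+1) ('X - (z`_i)%:P))^`() =
    k.+1%:R *: \prod_(u <- zeta) ('X - u%:P) by rewrite -dz [in RHS](big_nth 0) sz.
move=> i; apply: (@tendsto_eq _ _ _ _ _ (fun j => k.+1%:R^-1 *
    ((\prod_(0 <= l < k.+1) ('X - ((X j).1.1`_l)%:P))^`())`_i)).
  apply: nearW => j; rewrite -WE; have := Xc j.
  by case: (X j) => [[W V] b] [[_ _ dW] _] /=; rewrite dW coefZ mulKf.
have -> : (\prod_(u <- zeta) ('X - u%:P))`_i = k.+1%:R^-1 *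
    ((\prod_(0 <= l < k.+1) ('X - (z`_l)%:P))^`())`_i by rewrite dz' coefZ mulKf.
apply: tendstoM; first exact: tendsto_cst.
by apply: ptendsto_deriv; exact: Wlim.
Qed.

End Competitors.

Section RotatedCompetitors.
Context {R : realType}.
Local Notation C := R[i].

(** The unimodular factor, for nonzero [b], of the rotation that brings [b] to the positive real
    axis, as Delta beta has to be real. *)
Definition phase (b : C) : C := (normc b)%:C / b.

Lemma phaseK (b : C) : b != 0 -> phase b * b = (normc b)%:C.
Proof. by move=> b0; rewrite /phase divfK. Qed.

Lemma norm_phase (b : C) : b != 0 -> `|phase b| = 1.
Proof.
move=> b0; rewrite /phase -normcEC normrM normr_id normfV mulfV //.
by rewrite normr_eq0.
Qed.

Lemma tendsto_phase {T : Type} {F : set_system T} {FF : Filter F} (b : T -> C)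
    (beta : R) : 0 < beta -> tendsto (F := F) b beta%:C ->
  tendsto (F := F) (fun x => normc (b x)) beta /\
  tendsto (F := F) (fun x => phase (b x)) 1.
Proof.
move=> beta0 bl.
have nb : islittleo (F := F) (fun=> 1 : C) (fun x => (normc (b x) - beta)%:C).
  apply: islittleo_le bl; apply: nearW => x.
  have -> : (normc (b x) - beta)%:C = `|b x| - `|beta%:C|.
    by rewrite normcEC norm_real_complex (gtr0_norm beta0) rmorphB.
  exact: ler_dist_dist.
split; first exact: (islittleo_Re (fun=> 1 : R) _ nb).
have bc0 : beta%:C != 0 :> C by rewrite gt_eqF // ltcR.
rewrite -(mulfV bc0); apply: tendstoM.
  by apply: islittleo_eqfun nb => x; rewrite rmorphB.
exact: tendstoV.
Qed.

(** If z_i differs from beta, it lies within less than [r] of a critical point, and this strict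
    inequality persists for the nearby polynomial. The far root [b] is therefore paired with an
    entry equal to beta. *)
Lemma competitor_root_tendsto (k : nat) (z zeta : seq C) (r beta : R)
    (X : nat -> seq C * seq C * C) (v : nat -> seq C) :
  size zeta = k ->
  (forall i, (i < k.+1)%N -> z`_i != beta%:C ->
     exists2 l, (l < k)%N & cdist z`_i zeta`_l < r) ->
  (forall j, competitor k z r j.+1%:R^-1 (X j)) ->
  (forall j, perm_eq (X j).1.2 (v j)) ->
  (forall i, tendsto (F := \oo) (fun j => (v j)`_i) zeta`_i) ->
  tendsto (F := \oo) (fun j => (X j).2) beta%:C.
Proof.
move=> szeta near_zeta Xc vp vl.
have close : \forall j \near \oo, forall i, i \in iota 0 k.+1 ->
    z`_i != beta%:C -> exists2 s, s \in v j & cdist (X j).1.1`_i s < r.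
  apply: near_all => i; rewrite mem_iota /= add0n => ik.
  have [zi|zi] := eqVneq z`_i beta%:C; first exact: nearW.
  have [l lk lr] := near_zeta i ik zi.
  (* Half of the slack in the strict inequality, so that the perturbed distance stays below [r]. *)
  have e0 : 0 < ((r - cdist z`_i zeta`_l) / 2)%:C.
    by rewrite ltcR divr_gt0 // subr_gt0.
  have H : tendsto (F := \oo) (fun j => (X j).1.1`_i - (v j)`_l) (z`_i - zeta`_l).
    by apply: tendstoB; [exact: competitor_nth_tendsto Xc | exact: vl].
  move: H => /tendstoP /(_ _ e0); apply: filterS => j.
  rewrite normcEC lecR => Hj _; exists (v j)`_l.
    apply: mem_nth; rewrite -(perm_size (vp j)).
    by have := Xc j; case: (X j) => [[W V] b] [[_ sV _] _] /=; rewrite sV.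
  have := cdist_triangle (z`_i - zeta`_l) ((X j).1.1`_i - (v j)`_l) 0.
  by rewrite /cdist !subr0 => tri; move: lr Hj; rewrite /cdist; lra.
apply/tendstoP => e /posc_Re[e0 ->].
apply: filterS2 close (near_infty_natSinv_lt (PosNum e0)) => j clj je.
have := Xc j; have := vp j; case: (X j) clj => [[W V] b] /= clj pV.
move=> [[sW _ _] [_ zW bW far]].
have ik : (index b W < k.+1)%N by rewrite -sW index_mem.
have bE : W`_(index b W) = b by apply: nth_index.
move: (index b W) ik bE => i ik bE.
have zi : z`_i = beta%:C.
  apply/eqP/negP => /negP zi; have [|s sv] := clj i _ zi.
    by rewrite -[_ :: _]/(iota 0 k.+1) mem_iota.
  rewrite bE cdistC => sb; have := far s; rewrite (perm_mem pV) => /(_ sv).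
  by move=> /(lt_trans sb); rewrite ltxx.
rewrite -bE -zi normcEC lecR; apply: ltW; apply: lt_trans je.
by have := zW i ik; rewrite cdistC.
Qed.

End RotatedCompetitors.

Theorem mainTheorem2 (R : realType) (n : nat) (P : {poly R[i]})
    (beta a : R) (m : nat) (z zeta : seq R[i])
    (n_ge5 : (5 <= n)%N)
    (P_deg : size P = n.+1)
    (P_real : P \is a polyOver Num.real)
    (* the roots of P, those on the unit circle first *)
    (z_roots : lists_roots P z)
    (m_le : (m <= n)%N)
    (z_circle : forall i, (i < n)%N -> (`|z`_i| == 1) = (i < m)%N)
    (* the critical points of P *)
    (zeta_roots : lists_roots P^`() zeta)
    (propA : forall w, root P w -> `|w| <= 1)
    (propB : forall w, root P w -> `|w| = 1 -> mup w P = 1%N)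
    (propC : [/\ 0 < beta, beta < 1 & root P beta%:C])
    (propD : exists2 r : R, 0 < r &
       forall w, root P^`() w -> cdist w beta%:C = r)
    (propE : a < beta /\ mup a%:C P^`() = (n - 3)%N)
    (zeta_a : forall j, (2 <= j < n.-1)%N -> zeta`_j = a%:C)
    (propF : forall i, (i < n)%N -> z`_i != beta%:C ->
       mindist zeta z`_i < mindist zeta beta%:C /\ mindist zeta beta%:C < 1)
    (hG : propG n P beta a z zeta m)
    (hH : propH n beta a z zeta m) :
  locally_extremal n P.
Proof.
have [N nE] : exists N, n = N.+4.+1.
  by move: (n) n_ge5 => [|[|[|[|[|k]]]]] // _; exists k.
subst n; have [beta0 beta1 Pbeta] := propC; have [r r0 rD] := propD.
have [a_beta _] := propE.
have P0 : P != 0 by rewrite -size_poly_eq0 P_deg.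
have lP0 : lead_coef P != 0 by rewrite lead_coef_eq0.
have sz : size z = N.+4.+1.
  by apply/eqP; rewrite -eqSS -P_deg z_roots size_scale // size_prod_XsubC.
have [szeta dz dP] := lists_roots_deriv _ _ _ _ P_deg z_roots zeta_roots.
set lambda := N.+4.+1%:R * lead_coef P in dP.
have lambda0 : lambda != 0 by rewrite mulf_neq0 // pnatr_eq0.
have P'0 : P^`() != 0.
  by rewrite dP scaler_eq0 (negbTE lambda0) monic_neq0 // monic_prod_XsubC.
have zroot i : (i < N.+4.+1)%N -> root P z`_i.
  move=> iN; rewrite z_roots rootZ // root_prod_XsubC mem_nth ?sz //.
have zetadist j : (j < N.+4)%N -> cdist zeta`_j beta%:C = r.
  move=> jN; apply: rD; rewrite dP rootZ // root_prod_XsubC mem_nth ?szeta //.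
(* The radius is read off at the entry of index 2, which is [a]. *)
have rE : r = beta - a.
  rewrite -(zetadist 2) // zeta_a // cdistC /cdist -rmorphB.
  by apply: complexI; rewrite -normcEC norm_real_complex gtr0_norm // subr_gt0.
(* The root beta is at distance [r] from every critical point. So if dmax Q > dmax P, some root of Q
   is farther than [r] from all critical points of Q. *)
have rP : r <= dmax P.
  apply: le_trans (dmax_ge _ beta%:C _); last by rewrite mem_croots.
  apply: mindist_ge => [|w wP'].
    rewrite -size_eq0 -lt0n -ltnS -size_croots // dP size_scale //.
    by rewrite size_prod_XsubC szeta.
  by rewrite cdistC rD // -mem_croots.
split; first by split.
apply: contrapT => notext.
have comp (j : nat) : exists x, competitor N.+4 z r j.+1%:R^-1 x.
  have [Q QP dQ] : exists2 Q, in_nbhd N.+4.+1 j.+1%:R^-1 P Q & dmax P < dmax Q.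
    apply: contrapT => H; apply: notext; exists j.+1%:R^-1.
      by rewrite invr_gt0.
    move=> Q QP; rewrite leNgt; apply/negP => dQ; apply: H.
    by exists Q.
  apply: in_nbhd_competitor P_deg z_roots (ltW r0) QP _.
  exact: le_lt_trans rP dQ.
have [X Xc] := choice comp.
have [v [vp vl]] := competitor_critical_points _ _ _ _ _ sz szeta dz Xc.
have near_zeta i : (i < N.+4.+1)%N -> z`_i != beta%:C ->
    exists2 l, (l < N.+4)%N & cdist z`_i zeta`_l < r.
  move=> iN zi; have [mi _] := propF i iN zi.
  have zeta0 : zeta != [::] by rewrite -size_eq0 szeta.
  have [s sz' sr] := mindist_lt _ _ _ zeta0 mi.
  exists (index s zeta); first by rewrite -szeta index_mem.
  rewrite nth_index //.
  apply: lt_le_trans sr _; rewrite -(zetadist 0) // cdistC.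
  by apply: mindist_le; apply: mem_nth; rewrite szeta.
have bl := competitor_root_tendsto _ _ _ _ _ _ _ szeta near_zeta Xc vp vl.
have [nbl cl] := tendsto_phase _ _ beta0 bl.
have b0 : \forall j \near \oo, (X j).2 != 0.
  by apply: tendsto_neq bl _; rewrite gt_eqF // ltcR.
pose c j := phase (X j).2.
have im i : (i < m)%N -> (i < N.+4.+1)%N by move=> /leq_trans; apply.
have znorm i : (i < m)%N -> `|z`_i| = 1.
  by move=> i_m; apply/eqP; rewrite z_circle ?im.
have sv j : size (v j) = N.+4.
  rewrite -(perm_size (vp j)).
  by have := Xc j; case: (X j) => [[W V] b] [[_ sV _] _] /=.
apply: (@no_improving_perturbation R N m beta a P z zeta lambda szeta zeta_a a_beta _
  znorm _ _ lambda0 dP hG hH nat \oo _ (fun j => normc (X j).2)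
  (fun j l => c j * (v j)`_l) (fun j i => c j * (X j).1.1`_i) nbl).
- by move=> j jN; rewrite -rE; exact: zetadist.
- move=> i i_m; have := simple_root_deriv _ _ P0 (zroot i (im i i_m)).
  move=> /(_ (propB _ (zroot i (im i i_m)) (znorm i i_m))).
  by rewrite dP hornerZ mulf_eq0 negb_or => /andP[].
- move=> i i_m; apply: (mulfI lambda0); rewrite mulr0 -pintZ -dP pint_deriv.
  by rewrite (rootP (zroot i (im i i_m))) (rootP Pbeta) subrr.
- move=> l; rewrite -[X in tendsto _ X]mul1r; apply: tendstoM.
    exact: cl.
  exact: vl.
- by move=> j l lN; rewrite nth_default ?mulr0 // sv.
- move=> i i_m; rewrite -[X in tendsto _ X]mul1r; apply: tendstoM.
    exact: cl.
  by apply: competitor_nth_tendsto Xc; exact: im.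
- move=> i i_m; apply: filterS b0 => j bj; rewrite normrM norm_phase // mul1r.
  have := Xc j; case: (X j) => [[W V] b] [_ [+ _ _ _]] /=; apply.
  exact: im.
- move=> i i_m; apply: filterS b0 => j bj; rewrite -(phaseK _ bj).
  have -> : \prod_(0 <= l < N.+4) ('X - (c j * (v j)`_l)%:P) =
      \prod_(x <- [seq c j * x | x <- v j]) ('X - x%:P).
    by rewrite big_map [RHS](big_nth 0) sv.
  (* Before the rotation, the far root and W_i are both zeros of the product over [W], so the
     integral of its derivative between them vanishes. *)
  apply: pint_prod_XsubC_scale; rewrite -(perm_big _ (vp j)) /=.
  have := Xc j; case: (X j) => [[W V] b] /= [[sW _ dW] [_ _ bW _]].
  have k0 : N.+4.+1%:R != 0 :> R[i] by rewrite pnatr_eq0.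
  apply: (mulfI k0); rewrite mulr0 -pintZ -dW pint_deriv.
  have rootW u : u \in W -> (\prod_(x <- W) ('X - x%:P)).[u] = 0.
    by move=> uW; apply/rootP; rewrite root_prod_XsubC.
  by rewrite !rootW ?subrr // mem_nth // sW; exact: im.
- move=> l lN; apply: filterS b0 => j bj; rewrite -rE -(phaseK _ bj) -mulrBr.
  rewrite ComplexField.Normc.normcM.
  have -> : normc (c j) = 1 by apply: complexI; rewrite -normcEC norm_phase.
  rewrite mul1r.
  have : (v j)`_l \in (X j).1.2 by rewrite (perm_mem (vp j)) mem_nth // sv.
  by have := Xc j; case: (X j) => [[W V] b] /= [_ [_ _ _ +]]; apply.
Qed.
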